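(* Let $\phi:\mathbb{R}\to\mathbb{C}$ be defined by \[\phi(t)=\sum_{k\in\mathbb{Z}}\frac{e^{-4\pi^2 i k^2 t}-1}{-4\pi^2k^2},\] where the term $k=0$ is understood as its limiting value $it$. Then the Hausdorff dimension of the image $\phi(\mathbb{R})\subset\mathbb{C}\cong\mathbb{R}^2$ satisfies \[1\le \dim_{\mathcal H}\phi(\mathbb{R})\le \tfrac43 .\]
   Context: $\dim_{\mathcal H}$ denotes Hausdorff dimension in $\mathbb{R}^2$. *)

(* Defs.v *)
From HB Require Import structures.
From mathcomp Require Import all_boot all_order all_algebra.
From mathcomp Require Import all_classical all_reals all_analysis.
Set Implicit Arguments. Unset Strict Implicit. Unset Printing Implicit Defensive.
Import Order.TTheory GRing.Theory Num.Theory.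
Local Open Scope classical_set_scope.
Local Open Scope ring_scope.

(* Points of C ~ R^2 are pairs (real part, imaginary part). *)
Definition pt (R : realType) := (R * R)%type.

Definition dist2 {R : realType} (x y : pt R) : R :=
  Num.sqrt ((x.1 - y.1) ^+ 2 + (x.2 - y.2) ^+ 2).

(* Diameter of a subset of R^2 (an extended real; -oo for the empty set). *)
Definition diam {R : realType} (U : set (pt R)) : \bar R :=
  ereal_sup [set (dist2 x y)%:E | x in U & y in U].

Definition hterm {R : realType} (s : R) (U : set (pt R)) : \bar R :=
  if pselect (U = set0) then 0%E else ((fine (diam U)) `^ s)%:E.

Definition delta_cover {R : realType} (delta : R) (A : set (pt R))
  (U : nat -> set (pt R)) : Prop :=
  A `<=` \bigcup_i U i /\ forall i, (diam (U i) <= delta%:E)%E.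

Definition hausdorff_pre {R : realType} (s delta : R) (A : set (pt R)) : \bar R :=
  ereal_inf [set (\sum_(0 <= i <oo) hterm s (U i))%E | U in delta_cover delta A].

(* s-dimensional Hausdorff (outer) measure H^s(A) = lim_{delta -> 0+} H^s_delta(A)
   = sup_{delta > 0} H^s_delta(A) (monotone in delta). *)
Definition hausdorff_measure {R : realType} (s : R) (A : set (pt R)) : \bar R :=
  ereal_sup [set hausdorff_pre s delta A | delta in [set d : R | 0 < d]].

Definition hausdorff_dim {R : realType} (A : set (pt R)) : \bar R :=
  ereal_inf [set s%:E | s in [set s : R | 0 <= s /\ hausdorff_measure s A = 0%E]].

(* The function phi, written through its real and imaginary parts:
   for k <> 0, (e^{-4 pi^2 i k^2 t} - 1)/(-4 pi^2 k^2)
     = (1 - cos(4 pi^2 k^2 t))/(4 pi^2 k^2) + i sin(4 pi^2 k^2 t)/(4 pi^2 k^2),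
   the terms k and -k coincide, and the k = 0 term is i t. *)
Definition phi_re {R : realType} (t : R) : R :=
  2 * limn (fun n => \sum_(1 <= k < n)
     ((1 - cos (4 * pi ^+ 2 * (k%:R) ^+ 2 * t)) / (4 * pi ^+ 2 * (k%:R) ^+ 2))).

Definition phi_im {R : realType} (t : R) : R :=
  t + 2 * limn (fun n => \sum_(1 <= k < n)
     (sin (4 * pi ^+ 2 * (k%:R) ^+ 2 * t) / (4 * pi ^+ 2 * (k%:R) ^+ 2))).

Definition phi {R : realType} (t : R) : pt R := (phi_re t, phi_im t).

(* Main.v *)
(** Lower bound: the imaginary part of [phi] is continuous and at bounded distance from the
identity, so the projection of the image to the imaginary axis contains [[0, 1]]; a cover of the
image by sets of diameter at most 1 thus has [\sum diam^s >= \sum diam >= 1/2] for [s <= 1].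

Upper bound: put [x = 2 pi t].  If [p/q] is reduced and [|x - p/q| <= 1/q^2], Weyl differencing
gives [|\sum_(k <= n) exp(2 pi i k^2 x)| <= 7 n (H_q / q)^(1/2)] for [n >= q], where [H_q] is the
harmonic sum.  The difference [phi t - phi t0], [t0 = p / (2 pi q)], splits into the terms with
[k <= q], estimated by the mean value theorem since the derivative is a Weyl sum, and the tail,
estimated by Abel summation; both are [O(q^(-3/2) H_q^(1/2))].  By Dirichlet every irrational [x]
has such approximations with [q] arbitrarily large and [|p| <= q^(1 + eta)], so the image is covered
by countably many points and by pieces with [\sum diam^s = O(\sum_q q^(1 + eta - (3 - b) s / 2))]
over large [q], the tail of a convergent series when [s > 4/3] and [eta], [b] are small. *)
Require Import Defs.
From HB Require Import structures.
From mathcomp Require Import all_boot all_order all_algebra.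
From mathcomp Require Import all_classical all_reals all_analysis.
From mathcomp Require Import ring lra zify.
Set Implicit Arguments. Unset Strict Implicit. Unset Printing Implicit Defensive.
Import Order.TTheory GRing.Theory Num.Theory.
Import numFieldNormedType.Exports.
Local Open Scope classical_set_scope.
Local Open Scope ring_scope.

(** * Weyl sums *)

Section Sine.
Context {R : realType}.
Implicit Types a b x y z : R.

Lemma MVT_derive (f df : R -> R) a b : a <= b ->
  (forall x, is_derive x (1 : R) f (df x)) ->
  exists2 c, a <= c <= b & f b - f a = df c * (b - a).
Proof.
move=> ab Df.
have cf : {within `[a, b], continuous f}.
  by apply: derivable_within_continuous => u _; exact: (@ex_derive _ _ _ _ _ _ _ (Df u)).
have [c] := @MVT_segment R f df a b ab (fun u _ => Df u) cf.
by rewrite in_itv/=; exists c.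
Qed.

(** The difference [sin u - u * cos u] vanishes at 0 and has derivative [u * sin u], which is
    nonnegative up to [pi]. *)
Lemma mulr_cos_le_sin z : 0 <= z <= pi -> z * cos z <= sin z.
Proof.
move=> /andP[z0 zpi].
pose f := fun u : R => sin u - u * cos u.
have df (u : R) : is_derive u (1:R) f (u * sin u).
  rewrite /f; apply: is_derive_eq.
  rewrite /GRing.scale/=; ring.
have [c /andP[c0 cz]] := MVT_derive z0 df.
rewrite /f sin0 mul0r !subr0 => /eqP; rewrite subr_eq => /eqP ->.
rewrite lerDr mulr_ge0// mulr_ge0// sin_ge0_pi// c0/=; exact: le_trans zpi.
Qed.

(** By the half-angle formulas and [mulr_cos_le_sin], [sin z] is at least [z * cos (z / 2) ^+ 2],
    and [cos (z / 2) ^+ 2] is at least 1/2 because [cos z] is nonnegative. *)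
Lemma sin_ge_half z : 0 <= z <= pi / 2 -> z / 2 <= sin z.
Proof.
move=> /andP[z0 z2]; have pi0 := @pi_gt0 R.
have h : (z / 2) * cos (z / 2) <= sin (z / 2) by apply: mulr_cos_le_sin; lra.
have c0 : 0 <= cos (z / 2) by apply: cos_ge0_pihalf; lra.
have cz : 0 <= cos z by apply: cos_ge0_pihalf; lra.
have zz : z = (z / 2) *+ 2 by rewrite mulr2n; field.
have : cos z = cos (z / 2) ^+ 2 *+ 2 - 1 by rewrite {1}zz cos_mulr2n.
have : sin z = (cos (z / 2) * sin (z / 2)) *+ 2 by rewrite {1}zz sin_mulr2n.
move: h c0 cz; set c := cos _; set s := sin (z / 2) => h c0 cz -> cE.
have : c * (z / 2 * c) <= c * s by rewrite ler_wpM2l.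
rewrite cE in cz.
have : 0 <= z / 2 * (c ^+ 2 *+ 2 - 1) by rewrite mulr_ge0//; lra.
lra.
Qed.

Lemma sin_pi_ge y : 0 <= y <= 2^-1 -> y <= sin (pi * y).
Proof.
move=> /andP[y0 y2]; have p2 := @pi_ge2 R.
have : pi * y / 2 <= sin (pi * y).
  by apply: sin_ge_half; rewrite mulr_ge0// ?pi_ge0//= ler_wpM2l// pi_ge0.
apply: le_trans; nra.
Qed.

(** The minimum is the distance from [y] to the nearest integer; the half beyond 1/2 follows by
    reflecting [y] to [1 - y]. *)
Lemma sin_pi_ge_min y : 0 <= y <= 1 -> Num.min y (1 - y) <= sin (pi * y).
Proof.
move=> /andP[y0 y1]; have [y2|y2] := leP y 2^-1.
  by rewrite ge_min sin_pi_ge ?y0.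
have -> : sin (pi * y) = sin (pi * (1 - y)).
  by rewrite mulrBr mulr1 addrC sinDpi sinN opprK.
by rewrite ge_min [X in _ || X]sin_pi_ge ?orbT//; lra.
Qed.

Lemma norm_sin_piD y (n : int) : `|sin (pi * (y + n%:~R))| = `|sin (pi * y)|.
Proof.
have nat_case z (m : nat) : `|sin (pi * (z + m%:R))| = `|sin (pi * z)|.
  elim: m => [|m ih]; first by rewrite addr0.
  by rewrite -natr1 addrA mulrDr mulr1 sinDpi normrN.
case: n => m; first exact: nat_case.
by rewrite NegzE mulrNz -[in RHS](subrK m.+1%:R y) nat_case.
Qed.

(** Multiplying by [2 * sin (b / 2)] makes the sum telescope; the undivided form also covers
    [sin (b / 2) = 0]. *)
Lemma sum_cos_arith a b n :
  2 * sin (b / 2) * \sum_(l < n) cos (a + b * l%:R) =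
  sin (a - b / 2 + b * n%:R) - sin (a - b / 2).
Proof.
elim: n => [|n ih]; first by rewrite big_ord0 mulr0 mulr0 addr0 subrr.
rewrite big_ord_recr/= mulrDr ih.
have -> : a - b / 2 + b * n.+1%:R = (a + b * n%:R) + b / 2 by rewrite -natr1; field.
have -> : a - b / 2 + b * n%:R = (a + b * n%:R) - b / 2 by ring.
rewrite !sinD sinN cosN; ring.
Qed.

Lemma norm_sum_cos_arith_le a b n :
  `|\sum_(l < n) cos (a + b * l%:R)| * `|sin (b / 2)| <= 1.
Proof.
have := congr1 (fun z => `|z|) (sum_cos_arith a b n).
rewrite !normrM => h.
have : `|sin (a - b / 2 + b * n%:R) - sin (a - b / 2)| <= 1 + 1.
  by apply: le_trans (ler_normB _ _) _; apply: lerD; exact: sin_max.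
rewrite -h ger0_norm// => {}h; nra.
Qed.

Lemma norm_sum_cos_le n (f : nat -> R) : `|\sum_(l < n) cos (f l)| <= n%:R.
Proof.
apply: le_trans (ler_norm_sum _ _ _) _.
apply: (@le_trans _ _ (\sum_(l < n) 1)); first by apply: ler_sum => i _; exact: cos_max.
by rewrite sumr_const card_ord.
Qed.

End Sine.

(** * Weyl differencing and the bound for quadratic exponential sums *)

Section Weyl.
Context {R : realType}.
Implicit Types a b x y z : R.

(** This is the expansion of the squared modulus of the sum of [exp (i f k)]: the diagonal gives
    [n], and the off-diagonal pairs are grouped by their distance [j.+1]. *)
Lemma sqr_sum_cos_sin (f : nat -> R) n :
  (\sum_(k < n) cos (f k)) ^+ 2 + (\sum_(k < n) sin (f k)) ^+ 2 =
  n%:R + 2 * \sum_(j < n) \sum_(l < n.-1 - j) cos (f (l + j.+1)%N - f l).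
Proof.
elim: n => [|n ih]; first by rewrite !big_ord0; ring.
have -> : \sum_(j < n.+1) \sum_(l < n.+1.-1 - j) cos (f (l + j.+1)%N - f l) =
    \sum_(j < n) \sum_(l < n.-1 - j) cos (f (l + j.+1)%N - f l) +
    \sum_(l < n) cos (f n - f l).
  (* The new index [n] adds exactly one pair to each distance; reversing the order of [l] matches
     the pair (l, n) with its distance. *)
  rewrite big_ord_recr/= subnn big_ord0 addr0 [X in _ = _ + X](reindex_inj rev_ord_inj)/=.
  rewrite -big_split/=; apply: eq_bigr => j _.
  have -> : (n - j = (n.-1 - j).+1)%N by have := ltn_ord j; lia.
  rewrite big_ord_recr/=; congr (_ + cos (f _ - f _)).
  - by have := ltn_ord j; lia.
  - by have := ltn_ord j; lia.
rewrite !big_ord_recr/= [X in _ = _ + 2 * (_ + X)](eq_bigr (fun l : 'I_n =>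
  cos (f n) * cos (f l) + sin (f n) * sin (f l))); last by move=> l _; rewrite cosB.
rewrite big_split/= -!mulr_sumr -[n.+1%:R]natr1.
move: ih; set C := \sum_(k < n) cos _; set S := \sum_(k < n) sin _; set E := \sum_(j < n) _.
move=> ih; have h := cos2Dsin2 (f n).
have -> : (C + cos (f n)) ^+ 2 + (S + sin (f n)) ^+ 2 =
   (C ^+ 2 + S ^+ 2) + (cos (f n) ^+ 2 + sin (f n) ^+ 2) + 2 * (cos (f n) * C + sin (f n) * S).
  by ring.
rewrite ih h; ring.
Qed.

Definition harm (q : nat) : R := \sum_(r < q) r.+1%:R^-1.

Lemma harm_ge1 q : (0 < q)%N -> 1 <= harm q.
Proof.
case: q => // q _; rewrite /harm big_ord_recl/= invr1 lerDl.
by apply: sumr_ge0 => i _; rewrite invr_ge0.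
Qed.

Lemma le_harm m n : (m <= n)%N -> harm m <= harm n.
Proof.
move=> mn; rewrite /harm -!(big_mkord xpredT (fun r => r.+1%:R^-1)).
rewrite (big_cat_nat (leq0n m) mn)/= lerDl.
by apply: sumr_ge0 => i _; rewrite invr_ge0.
Qed.

(* min(n, 1 / |sin (pi y)|), also when the sine vanishes *)
Definition gbound (n : nat) y : R :=
  if `|sin (pi * y)| * n%:R <= 1 then n%:R else `|sin (pi * y)|^-1.

Lemma gbound_ge0 n y : 0 <= gbound n y.
Proof. by rewrite /gbound; case: ifP => _ //; rewrite invr_ge0. Qed.

Lemma gbound_le n y : gbound n y <= n%:R.
Proof.
rewrite /gbound; case: ifP => // /negbT; rewrite -ltNge => h.
have s0 : 0 < `|sin (pi * y)|.
  by rewrite lt_neqAle normr_ge0 andbT eq_sym; apply: contraTneq h => ->; rewrite mul0r ltr10.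
by rewrite -[X in X <= _]mul1r ler_pdivrMr// mulrC ltW.
Qed.

Lemma gbound_le_inv n y c : 0 < c -> c <= `|sin (pi * y)| -> gbound n y <= c^-1.
Proof.
move=> c0 cs; have s0 := lt_le_trans c0 cs.
have h : `|sin (pi * y)|^-1 <= c^-1 by rewrite lef_pV2.
apply: le_trans h; rewrite /gbound; case: ifP => // h.
by rewrite -[X in _ <= X]mul1r ler_pdivlMr// mulrC.
Qed.

Lemma le_gbound n y u : u <= n%:R -> u * `|sin (pi * y)| <= 1 -> u <= gbound n y.
Proof.
move=> un us; rewrite /gbound; case: ifP => // /negbT; rewrite -ltNge => h.
have s0 : 0 < `|sin (pi * y)|.
  by rewrite lt_neqAle normr_ge0 andbT eq_sym; apply: contraTneq h => ->; rewrite mul0r ltr10.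
by rewrite -[X in _ <= X]mul1r ler_pdivlMr.
Qed.

Lemma gboundDz n y (m : int) : gbound n (y + m%:~R) = gbound n y.
Proof. by rewrite /gbound norm_sin_piD. Qed.

(** Bounds [gbound n y] when [y] lies in [0, 1/2] at or above (r - 1)/q; for [r < 2] this gives no
    positive lower bound on [y], and the trivial bound [n] remains. *)
Definition rbound (n q r : nat) : R := if (r < 2)%N then n%:R else q%:R / r.-1%:R.

Lemma rbound_ge0 n q r : 0 <= rbound n q r.
Proof. by rewrite /rbound; case: ifP => _ //; rewrite divr_ge0. Qed.

Lemma sum_rbound n q m : \sum_(r < m) rbound n q r <= 2 * n%:R + q%:R * harm m.
Proof.
have nn : 0 <= n%:R :> R by [].
have hm k : 0 <= harm k by apply: sumr_ge0 => i _; rewrite invr_ge0.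
have qh k : 0 <= q%:R * harm k by rewrite mulr_ge0.
case: m => [|[|m]].
- by rewrite big_ord0; have := qh 0%N; lra.
- by rewrite big_ord1 /rbound/=; have := qh 1%N; lra.
have -> : \sum_(r < m.+2) rbound n q r = 2 * n%:R + q%:R * harm m.
  rewrite !big_ord_recl/= /rbound/= /harm mulr_sumr; ring.
by rewrite lerD2l ler_wpM2l// le_harm// ltnW.
Qed.

(** The first summand serves when 0 is the integer nearest to [y], the second when it is 1: there
    [1 - y] is at least ((q - 1 - r) - 1)/q. The two exceptional indices at either end take the
    trivial bound. *)
Lemma gbound_le_rbound n q r y : (r < q)%N ->
  r%:R - 1 <= q%:R * y <= r%:R + 2 ->
  gbound n y <= rbound n q r + rbound n q (q.-1 - r).
Proof.
move=> rq /andP[yl yr].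
have [r2|r2] := ltnP r 2.
  rewrite [X in _ <= X + _]/rbound r2.
  by have := gbound_le n y; have := rbound_ge0 n q (q.-1 - r); lra.
have [s2|s2] := ltnP (q.-1 - r) 2.
  rewrite [X in _ <= _ + X]/rbound s2.
  by have := gbound_le n y; have := rbound_ge0 n q r; lra.
rewrite /rbound ltnNge r2 ltnNge s2/=.
have [r' rE] : exists r', (r = r'.+2)%N by exists r.-2; lia.
have [s' sE] : exists s', (q.-1 - r = s'.+2)%N by exists (q.-1 - r).-2; lia.
have qE : q = (r' + s' + 5)%N by lia.
rewrite sE rE/=; have qR : q%:R = r'%:R + s'%:R + 5 :> R by rewrite qE !natrD.
rewrite {}rE -!natr1 in yl yr.
have r'0 : 0 <= r'%:R :> R by []. have s'0 : 0 <= s'%:R :> R by [].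
have q0 : 0 < q%:R :> R by lra.
have y0 : 0 <= y by rewrite -(pmulr_rge0 _ q0); lra.
have y1 : y <= 1 by rewrite -(ler_pM2l q0); lra.
have hs : Num.min y (1 - y) <= sin (pi * y) by apply: sin_pi_ge_min; rewrite y0.
have s0 : 0 <= sin (pi * y) by apply: le_trans hs; rewrite le_min y0 subr_ge0.
have a0 : 0 <= q%:R / r'.+1%:R :> R by rewrite divr_ge0.
have b0 : 0 <= q%:R / s'.+1%:R :> R by rewrite divr_ge0.
have [h|h] := leP y (1 - y).
- have : gbound n y <= (r'.+1%:R / q%:R)^-1.
    apply: gbound_le_inv; first by rewrite divr_gt0.
    rewrite ger0_norm//; apply: le_trans hs; rewrite (min_idPl h).
    by rewrite ler_pdivrMr// mulrC -natr1; lra.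
  by rewrite invf_div => /le_trans; apply; rewrite lerDl.
- have : gbound n y <= (s'.+1%:R / q%:R)^-1.
    apply: gbound_le_inv; first by rewrite divr_gt0.
    rewrite ger0_norm//; apply: le_trans hs; rewrite (min_idPr (ltW h)).
    by rewrite ler_pdivrMr// mulrC -natr1; lra.
  by rewrite invf_div => /le_trans; apply; rewrite lerDr.
Qed.

(** Modulo 1 the points [y + j x] stay within O(1/q) of fractions r/q, and each residue [r] occurs
    once since [p] is invertible modulo [q]. Summing [rbound] over [r] and over the reflected index
    gives the two halves of the bound. *)
Lemma sum_gbound_block n q (p : int) x y : (0 < q)%N -> coprimez p q ->
  `|x - p%:~R / q%:R| <= (q%:R ^+ 2)^-1 ->
  \sum_(j < q) gbound n (y + j%:R * x) <= 4 * n%:R + 2 * (q%:R * harm q).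
Proof.
case: q => // q' _; set q := q'.+1 => pq xpq.
have q0 : 0 < q%:R :> R by [].
pose b : int := Num.floor (q%:R * y).
pose rz (j : nat) : int := ((b + j%:Z * p) %% q%:Z)%Z.
have rz0 j : 0 <= rz j by apply: modz_ge0.
have rzq j : rz j < q%:Z by apply: ltz_pmod.
have rq j : (`|rz j| < q)%N by have := rz0 j; have := rzq j; lia.
pose rj (j : 'I_q) : 'I_q := Ordinal (rq j).
(* Equal residues make [q] divide (i - j) p, hence i - j, which is smaller than [q] in absolute
   value. *)
have rj_inj : injective rj.
  move=> i j /(congr1 val)/= /(congr1 Posz); rewrite !gez0_abs// => /eqP.
  rewrite /rz eqz_mod_dvd.
  have -> : b + i%:Z * p - (b + j%:Z * p) = (i%:Z - j%:Z) * p by ring.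
  rewrite Gauss_dvdzl; last by rewrite coprimez_sym.
  move=> /dvdzP[k hk]; apply/val_inj => /=.
  have iq := ltn_ord i; have jq := ltn_ord j.
  have k0 : k = 0 by case: (ltgtP k 0) => // k0; nia.
  by move: hk; rewrite k0 mul0r; lia.
apply: (@le_trans _ _ (\sum_(j < q) (rbound n q (rj j) + rbound n q (rev_ord (rj j))))).
  apply: ler_sum => j _.
  have jE : b + j%:Z * p = ((b + j%:Z * p) %/ q%:Z)%Z * q%:Z + rz j by exact: divz_eq.
  set m := ((b + j%:Z * p) %/ q%:Z)%Z in jE.
  have -> : y + j%:R * x = (y + j%:R * x - m%:~R) + m%:~R by rewrite subrK.
  rewrite gboundDz /rev_ord/= -[(q - _.+1)%N]/(q.-1 - _)%N.
  apply: gbound_le_rbound => //.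
  have rR : `|rz j|%:R = (rz j)%:~R :> R by rewrite -[in RHS](gez0_abs (rz0 j)).
  have bR : b%:~R + j%:R * p%:~R = m%:~R * q%:R + (rz j)%:~R :> R.
    by have := congr1 (fun z : int => z%:~R : R) jE; rewrite !rmorphD/= !rmorphM.
  have bl : b%:~R <= q%:R * y by exact: floor_le.
  have bu : q%:R * y < b%:~R + 1 by rewrite -[1]/(1%:~R) -rmorphD/= floorD1_gt.
  have xd : `|q%:R * j%:R * (x - p%:~R / q%:R)| <= 1.
    rewrite !normrM !normr_nat; apply: (@le_trans _ _ (q%:R * q%:R * (q%:R ^+ 2)^-1)).
      apply: ler_pM => //; rewrite ler_wpM2l// ler_nat; exact/ltnW/ltn_ord.
    by rewrite -expr2 divff// gt_eqF// exprn_gt0.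
  (* The residue is perturbed by the fractional part of [q y], in [0, 1), and by an error in
     [-1, 1]; this is the window from r - 1 to r + 2. *)
  have e : q%:R * (y + j%:R * x - m%:~R) =
      (q%:R * y - b%:~R) + (rz j)%:~R + q%:R * j%:R * (x - p%:~R / q%:R).
    have -> : (rz j)%:~R = b%:~R + j%:R * p%:~R - m%:~R * q%:R :> R by rewrite bR; ring.
    by field; rewrite gt_eqF.
  rewrite e rR; move: xd; rewrite ler_norml => /andP[xl xu].
  by apply/andP; split; lra.
rewrite big_split/=.
have -> : \sum_(j < q) rbound n q (rj j) = \sum_(r < q) rbound n q r.
  by rewrite [RHS](reindex_inj rj_inj).
have -> : \sum_(j < q) rbound n q (rev_ord (rj j)) = \sum_(r < q) rbound n q r.
  by rewrite [RHS](reindex_inj (inj_comp rev_ord_inj rj_inj)).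
by have := sum_rbound n q q; lra.
Qed.

Lemma sum_gbound_blocks n q (p : int) x m : (0 < q)%N -> coprimez p q ->
  `|x - p%:~R / q%:R| <= (q%:R ^+ 2)^-1 ->
  \sum_(j < q * m) gbound n (j%:R * x) <= m%:R * (4 * n%:R + 2 * (q%:R * harm q)).
Proof.
move=> q0 pq xpq; elim: m => [|m ih]; first by rewrite muln0 big_ord0 mul0r.
rewrite mulnS addnC big_split_ord/= -natr1 mulrDl mul1r; apply: lerD => //.
rewrite (eq_bigr (fun j : 'I_q => gbound n ((q * m)%:R * x + j%:R * x))).
  exact: sum_gbound_block pq xpq.
by move=> j _; rewrite natrD mulrDl.
Qed.

(** Differencing a square produces only even multiples of [x]; adding the odd ones restores sums
    over full blocks. *)
Lemma sum_even_le n (F : nat -> R) : (forall i, 0 <= F i) ->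
  \sum_(j < n) F (2 * j.+1)%N <= \sum_(i < (2 * n).+1) F i.
Proof.
move=> F0; elim: n => [|n ih]; first by rewrite big_ord0 big_ord1.
rewrite mulnS [X in X <= _]big_ord_recr 2!big_ord_recr/=.
have -> : (2 * n.+1 = (2 + 2 * n))%N by lia.
by have := F0 (2 * n).+1; rewrite !add2n; lra.
Qed.

Lemma weyl_sum_le n q (p : int) x : (0 < q <= n)%N -> coprimez p q ->
  `|x - p%:~R / q%:R| <= (q%:R ^+ 2)^-1 ->
  (\sum_(k < n) cos (2 * pi * x * k.+1%:R ^+ 2)) ^+ 2 +
  (\sum_(k < n) sin (2 * pi * x * k.+1%:R ^+ 2)) ^+ 2 <= 49 * (n%:R ^+ 2 * harm q / q%:R).
Proof.
move=> /andP[q0 qn] pq xpq.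
rewrite (sqr_sum_cos_sin (fun k => 2 * pi * x * k.+1%:R ^+ 2)).
(* For a fixed shift the phase difference is linear in [l], so the inner sum is a cosine sum over an
   arithmetic progression. *)
have h1 : \sum_(j < n) \sum_(l < n.-1 - j)
    cos (2 * pi * x * (l + j.+1).+1%:R ^+ 2 - 2 * pi * x * l.+1%:R ^+ 2) <=
    \sum_(j < n) gbound n ((2 * j.+1)%:R * x).
  apply: ler_sum => j _; apply: (le_trans (ler_norm _)); apply: le_gbound.
    apply: (le_trans (norm_sum_cos_le _ (fun l =>
      2 * pi * x * (l + j.+1).+1%:R ^+ 2 - 2 * pi * x * l.+1%:R ^+ 2))).
    by rewrite ler_nat; lia.
  set b := 2 * (2 * pi * x * j.+1%:R).
  rewrite (eq_bigr (fun l : 'I__ => cos ((2 * pi * x * (j.+1%:R ^+ 2 + 2 * j.+1%:R)) + b * l%:R))).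
    have -> : pi * ((2 * j.+1)%:R * x) = b / 2 by rewrite /b natrM; field.
    exact: norm_sum_cos_arith_le.
  by move=> l _; congr (cos _); rewrite /b -addSn natrD -[l.+1%:R]natr1; ring.
have h2 : \sum_(j < n) gbound n ((2 * j.+1)%:R * x) <=
    \sum_(i < q * ((2 * n) %/ q).+1) gbound n (i%:R * x).
  apply: (le_trans (@sum_even_le n (fun i => gbound n (i%:R * x)) _)) => [i|].
    exact: gbound_ge0.
  have le : ((2 * n).+1 <= q * ((2 * n) %/ q).+1)%N.
    by rewrite [(q * _)%N]mulnC ltn_ceil.
  rewrite -!(big_mkord xpredT (fun i => gbound n (i%:R * x))).
  rewrite (big_cat_nat (leq0n _) le)/= lerDl.
  by apply: sumr_ge0 => i _; exact: gbound_ge0.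
have h3 := sum_gbound_blocks n ((2 * n) %/ q).+1 q0 pq xpq.
have hq : 1 <= harm q by exact: harm_ge1.
have qR : 0 < q%:R :> R by rewrite ltr0n.
have qnR : q%:R <= n%:R :> R by rewrite ler_nat.
(* [B] blocks of length [q] contain all indices up to 2n, and [q <= n] keeps their total length
   below 3n. *)
set B := ((2 * n) %/ q).+1 in h2 h3.
have hB : B%:R * q%:R <= 3 * n%:R :> R.
  rewrite -natrM -natrM ler_nat; have := leq_trunc_div (2 * n) q; rewrite /B; lia.
have n0 : 0 < n%:R :> R by lra.
have hB' : B%:R <= 3 * n%:R / q%:R :> R by rewrite ler_pdivlMr.
have h4 : B%:R * (4 * n%:R + 2 * (q%:R * harm q)) <= (3 * n%:R / q%:R) * (6 * (n%:R * harm q)).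
  apply: ler_pM => //; first by rewrite addr_ge0// mulr_ge0// mulr_ge0//; lra.
  have : q%:R * harm q <= n%:R * harm q by rewrite ler_wpM2r//; lra.
  have : n%:R * 1 <= n%:R * harm q by rewrite ler_wpM2l//; lra.
  lra.
have h5 : n%:R <= n%:R ^+ 2 * harm q / q%:R.
  by rewrite ler_pdivlMr// expr2 -mulrA ler_wpM2l//; nra.
have h6 : (3 * n%:R / q%:R) * (6 * (n%:R * harm q)) = 18 * (n%:R ^+ 2 * harm q / q%:R).
  by rewrite expr2; field; rewrite gt_eqF.
(* The total is at most 1 + 2 * 18 = 37 times [T]; 49 is the next perfect square, so that its root
   is 7. *)
rewrite h6 in h4; move: h1 h2 h3 h4 h5.
set T := n%:R ^+ 2 * _ / _; move=> h1 h2 h3 h4 h5; lra.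
Qed.

Lemma weyl_sum_cos_sin n q (p : int) x : (0 < q <= n)%N -> coprimez p q ->
  `|x - p%:~R / q%:R| <= (q%:R ^+ 2)^-1 ->
  `|\sum_(k < n) cos (2 * pi * x * k.+1%:R ^+ 2)| <= n%:R * (7 * Num.sqrt (harm q / q%:R)) /\
  `|\sum_(k < n) sin (2 * pi * x * k.+1%:R ^+ 2)| <= n%:R * (7 * Num.sqrt (harm q / q%:R)).
Proof.
move=> qn pq xpq; have := weyl_sum_le qn pq xpq.
have hq : 0 <= harm q / q%:R.
  by rewrite divr_ge0//; apply: sumr_ge0 => i _; rewrite invr_ge0.
set C := \sum_(k < n) cos _; set S := \sum_(k < n) sin _.
have -> : 49 * (n%:R ^+ 2 * harm q / q%:R) = (n%:R * (7 * Num.sqrt (harm q / q%:R))) ^+ 2.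
  rewrite 2!exprMn sqr_sqrtr//; ring.
set B := n%:R * _ => CS; have B0 : 0 <= B by rewrite /B !mulr_ge0// sqrtr_ge0.
by split; rewrite -[X in _ <= X]ger0_norm// -ler_sqr ?nnegrE// !real_normK ?num_real//;
  have := sqr_ge0 S; have := sqr_ge0 C; lra.
Qed.

End Weyl.

(** * Increments of phi near rational points *)

Section Series.
Context {R : realType}.
Implicit Types (t : R) (f df : R -> R).

(** Summation by parts: a partial sum of size at most [(m + 1) B] times the drop of the weight is at
    most 2B(1/(m + 1) - 1/(m + 2)), which telescopes. *)
Lemma abel_tail (a : nat -> R) (B : R) q n : (0 < q <= n)%N ->
  (forall m, (q <= m)%N -> `|\sum_(k < m) a k| <= m%:R * B) ->
  `|\sum_(q <= k < n) a k / k.+1%:R ^+ 2| <= 4 * (B / q%:R).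
Proof.
move=> /andP[q0 qn] hA.
pose A m : R := \sum_(k < m) a k.
have B0 : 0 <= B.
  have := le_trans (normr_ge0 _) (hA q (leqnn _)).
  by rewrite pmulr_rge0// ltr0n.
(* The induction keeps both boundary terms inside the norm. In the end the telescoped part costs
   twice B/q and each boundary term once, hence the factor 4. *)
have key d : `|\sum_(q <= k < q + d) a k / k.+1%:R ^+ 2
    - A (q + d)%N / (q + d).+1%:R ^+ 2 + A q / q.+1%:R ^+ 2| <=
    2 * (B * (q.+1%:R^-1 - (q + d).+1%:R^-1)).
  elim: d => [|d ih].
    by rewrite addn0 big_geq// add0r addNr subrr normr0 !mulr0.
  rewrite addnS big_nat_recr ?leq_addr//=.
  set m := (q + d)%N in ih *; set T := \sum_(q <= k < m) _ in ih *.
  have AS : a m = A m.+1 - A m by rewrite /A big_ord_recr/=; ring.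
  have -> : T + a m / m.+1%:R ^+ 2 - A m.+1 / m.+2%:R ^+ 2 + A q / q.+1%:R ^+ 2 =
    (T - A m / m.+1%:R ^+ 2 + A q / q.+1%:R ^+ 2) +
    A m.+1 * ((m.+1%:R ^+ 2)^-1 - (m.+2%:R ^+ 2)^-1) by rewrite AS; ring.
  apply: (le_trans (ler_normD _ _)).
  have m0 : 0 <= m%:R :> R by [].
  have e : (m.+1%:R ^+ 2)^-1 - (m.+2%:R ^+ 2)^-1 =
     (2 * m%:R + 3) / (m.+1%:R ^+ 2 * m.+2%:R ^+ 2) :> R.
    by rewrite -[m.+2%:R]natr1 -[m.+1%:R]natr1; field; apply/andP; split; lra.
  have e2 : m.+1%:R^-1 - m.+2%:R^-1 = (m.+1%:R * m.+2%:R)^-1 :> R.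
    by rewrite -[m.+2%:R]natr1 -[m.+1%:R]natr1; field; apply/andP; split; lra.
  have h2 : `|A m.+1 * ((m.+1%:R ^+ 2)^-1 - (m.+2%:R ^+ 2)^-1)| <=
     2 * (B * (m.+1%:R^-1 - m.+2%:R^-1)).
    rewrite e e2 normrM [X in _ * X]ger0_norm; last by rewrite divr_ge0//; lra.
    apply: (@le_trans _ _ (m.+1%:R * B * ((2 * m%:R + 3) / (m.+1%:R ^+ 2 * m.+2%:R ^+ 2)))).
      rewrite ler_wpM2r//.
      by apply: hA; rewrite /m; lia.
    have -> : m.+1%:R * B * ((2 * m%:R + 3) / (m.+1%:R ^+ 2 * m.+2%:R ^+ 2)) =
       B * ((m.+1%:R * m.+2%:R)^-1 * ((2 * m%:R + 3) / m.+2%:R)) :> R.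
      by rewrite -[m.+2%:R]natr1 -[m.+1%:R]natr1; field; apply/andP; split; lra.
    rewrite [X in _ <= X]mulrCA ler_wpM2l// [X in _ <= X]mulrC ler_wpM2l// ?invr_ge0 ?mulr_ge0//.
    by rewrite ler_pdivrMr// -[m.+2%:R]natr1 -[m.+1%:R]natr1; lra.
  apply: (le_trans (lerD ih h2)); by rewrite -!mulrDr addrA subrK.
have := key (n - q)%N; rewrite subnKC//.
set T := \sum_(q <= k < n) _ => hT.
have hm m : (q <= m)%N -> `|A m / m.+1%:R ^+ 2| <= B / q%:R.
  move=> qm; rewrite normrM [X in _ * X]ger0_norm ?invr_ge0 ?sqr_ge0//.
  rewrite ler_pdivrMr ?exprn_gt0//; apply: (le_trans (hA _ qm)).
  rewrite mulrC -mulrA ler_wpM2l// -[X in X <= _]mulr1 expr2 mulrA.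
  have qm1 : q%:R <= m.+1%:R :> R by rewrite ler_nat ltnW.
  have h1 : 1 <= q%:R^-1 * m.+1%:R :> R by rewrite mulrC ler_pdivlMr ?ltr0n// mul1r.
  have h2 : m%:R <= m.+1%:R :> R by rewrite ler_nat.
  have m0 : 0 <= m%:R :> R by [].
  by nra.
have h1 := hm n qn; have h2 := hm q (leqnn _).
have h3 : B * (q.+1%:R^-1 - n.+1%:R^-1) <= B / q%:R.
  rewrite ler_wpM2l//; apply: (@le_trans _ _ q.+1%:R^-1).
    by rewrite gerBl invr_ge0.
  by rewrite lef_pV2 ?posrE ?ltr0n// ler_nat.
move: hT h1 h2; set u := A n / _; set v := A q / _ => hT h1 h2.
have -> : T = (T - u + v) + u - v by ring.
apply: (le_trans (ler_normB _ _)); apply: (le_trans (lerD (ler_normD _ _) (lexx _))).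
by move: hT h1 h2 h3; set w := B / q%:R; set z := B * _ => hT h1 h2 h3; lra.
Qed.

(** Frequency, and also denominator, of the term of index k + 1; the shift keeps it positive. *)
Definition lam (k : nat) : R := 4 * pi ^+ 2 * k.+1%:R ^+ 2.

Lemma pi4_ge : 16 <= 4 * pi ^+ 2 :> R.
Proof. by have := @pi_ge2 R => p2; nra. Qed.

Lemma lam_gt0 k : 0 < lam k.
Proof. by rewrite mulr_gt0 ?exprn_gt0//; have := pi4_ge; lra. Qed.

(** The factor [lam k] from the chain rule cancels the denominator, so the derivative of a partial
    sum of [phi] is a Weyl sum. *)
Lemma is_derive_partial f df n : (forall x, is_derive x (1 : R) f (df x)) ->
  forall x : R, is_derive x (1 : R) (fun t => \sum_(k < n) f (lam k * t) / lam k)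
    (\sum_(k < n) df (lam k * x)).
Proof.
move=> Df x; elim: n => [|n ih].
  rewrite big_ord0 (_ : (fun _ => _) = cst 0); first exact: is_derive_cst.
  by apply/funext => t; rewrite big_ord0.
rewrite big_ord_recr/=.
rewrite (_ : (fun t => _) = (fun t => \sum_(k < n) f (lam k * t) / lam k) +
  (fun t => (lam n)^-1 *: (f \o ( *%R (lam n))) t)); last first.
  by apply/funext => t; rewrite big_ord_recr/=; congr (_ + _); rewrite mulrC.
apply: is_deriveD.
have D1 : is_derive x (1 : R) (f \o ( *%R (lam n))) (df (lam n * x) * lam n).
  apply: is_derive1_comp => //.
  have h : is_derive x (1 : R) (lam n \*: (@id R)) (lam n *: (1 : R)) by exact: is_deriveZ.
  by apply: (is_derive_eq h); rewrite /GRing.scale/= mulr1.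
apply: is_derive_eq; by rewrite /GRing.scale/= mulrC mulfK// gt_eqF// lam_gt0.
Qed.

(** The first [q] terms are handled together by the mean value theorem, the tails at [t] and at [t0]
    separately by [abel_tail]. Cutting at [q] balances both parts when |t - t0| is of order
    1/q^2. *)
Lemma partial_diff_le f df (W t0 t : R) q n : (0 < q <= n)%N ->
  (forall x, is_derive x (1 : R) f (df x)) ->
  (forall c, `|c - t0| <= `|t - t0| -> `|\sum_(k < q) df (lam k * c)| <= q%:R * W) ->
  (forall c m, `|c - t0| <= `|t - t0| -> (q <= m)%N ->
     `|\sum_(k < m) f (lam k * c)| <= m%:R * W) ->
  `|\sum_(k < n) (f (lam k * t) / lam k - f (lam k * t0) / lam k)| <=
    `|t - t0| * (q%:R * W) + W / q%:R / 2.
Proof.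
move=> qn Df hdf hf.
have q0 : 0 < q%:R :> R by rewrite ltr0n; case/andP: qn.
rewrite -(big_mkord xpredT (fun k => f (lam k * t) / lam k - f (lam k * t0) / lam k)).
case/andP: (qn) => q1 qn2.
rewrite (big_cat_nat (leq0n q) qn2)/= !big_mkord.
have tail c : `|c - t0| <= `|t - t0| ->
    `|\sum_(q <= k < n) f (lam k * c) / lam k| <= W / q%:R / 4.
  move=> hc; have -> : \sum_(q <= k < n) f (lam k * c) / lam k =
    (4 * pi ^+ 2)^-1 * \sum_(q <= k < n) f (lam k * c) / k.+1%:R ^+ 2.
    rewrite mulr_sumr; apply: eq_bigr => k _.
    have -> : (lam k)^-1 = (4 * pi ^+ 2)^-1 / k.+1%:R ^+ 2 by rewrite -invfM.
    by rewrite mulrCA.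
  have h := @abel_tail (fun k => f (lam k * c)) W q n qn (fun m => @hf c m hc).
  rewrite normrM ger0_norm ?invr_ge0; last by have := pi4_ge; lra.
  (* This turns the factor 4 of [abel_tail] into 1/4 for each of the two tails. *)
  have h16 : (4 * pi ^+ 2)^-1 <= 16^-1 :> R by rewrite lef_pV2 ?posrE ?pi4_ge//; have := pi4_ge; lra.
  have : (4 * pi ^+ 2)^-1 * `|\sum_(q <= k < n) f (lam k * c) / k.+1%:R ^+ 2| <=
     16^-1 * (4 * (W / q%:R)).
    by apply: ler_pM => //; rewrite invr_ge0; have := pi4_ge; lra.
  by set u := W / q%:R; lra.
have head : `|\sum_(k < q) (f (lam k * t) / lam k - f (lam k * t0) / lam k)| <=
    `|t - t0| * (q%:R * W).
  rewrite sumrB.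
  have DF := is_derive_partial q Df.
  have mvt a b : a <= b -> (forall c, a <= c <= b -> `|c - t0| <= `|t - t0|) ->
     `|\sum_(k < q) f (lam k * b) / lam k - \sum_(k < q) f (lam k * a) / lam k| <=
     `|b - a| * (q%:R * W).
    move=> ab hab; have [c cab ->] := MVT_derive ab DF.
    by rewrite normrM mulrC ler_wpM2l// hdf// hab.
  have [tt|tt] := leP t0 t.
    apply: mvt => // c /andP[c1 c2]; rewrite !ger0_norm ?subr_ge0//; lra.
  rewrite distrC [`|t - t0|]distrC; apply: (mvt _ _ (ltW tt)) => c /andP[c1 c2].
  by rewrite !ler0_norm ?subr_le0//; lra.
apply: (le_trans (ler_normD _ _)); apply: lerD => //.
rewrite sumrB; apply: (le_trans (ler_normB _ _)).
have h1 := tail t (lexx _); have h2 : `|t0 - t0| <= `|t - t0| by rewrite subrr normr0.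
have := tail t0 h2; lra.
Qed.

Lemma cvg_series_bounded (u : R ^nat) (M : R) :
  (forall n, \sum_(k < n) `|u k| <= M) -> cvgn (series u).
Proof.
move=> h; apply: normed_cvg; apply: nondecreasing_is_cvgn.
  by apply: nondecreasing_series => n _ _; exact: normr_ge0.
by exists M => _ [n _ <-]; have := h n; rewrite -(big_mkord xpredT (fun k => `|u k|)).
Qed.

Lemma lim_series_norm_le (u : R ^nat) (B : R) q : cvgn (series u) ->
  (forall n, (q <= n)%N -> `|\sum_(k < n) u k| <= B) -> `|limn (series u)| <= B.
Proof.
move=> cu h.
have h' n : (q <= n)%N -> - B <= series u n <= B.
  by move=> /h; rewrite ler_norml /series/= big_mkord.
rewrite ler_norml; apply/andP; split.
- apply: limr_ge => //; exists q => // n /= qn; by case/andP: (h' n qn).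
- apply: limr_le => //; exists q => // n /= qn; by case/andP: (h' n qn).
Qed.

Lemma sum_inv_sqr_le n : \sum_(k < n) (k.+1%:R ^+ 2)^-1 <= 2 * (1 - n.+1%:R^-1) :> R.
Proof.
elim: n => [|n ih]; first by rewrite big_ord0 invr1 subrr mulr0.
rewrite big_ord_recr/=.
have n0 : 0 <= n%:R :> R by [].
have h : (n.+1%:R ^+ 2)^-1 <= 2 * (n.+1%:R^-1 - n.+2%:R^-1) :> R.
  have -> : 2 * (n.+1%:R^-1 - n.+2%:R^-1) = 2 / (n.+1%:R * n.+2%:R) :> R.
    by rewrite -[n.+2%:R]natr1 -[n.+1%:R]natr1; field; apply/andP; split; lra.
  rewrite ler_pdivlMr; last by rewrite mulr_gt0.
  rewrite mulrC ler_pdivrMr ?exprn_gt0// expr2 -[n.+2%:R]natr1 -[n.+1%:R]natr1.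
  by nra.
apply: (le_trans (lerD ih h)); by rewrite -mulrDr addrA subrK.
Qed.

Lemma norm_term_le f k (x : R) : `|f x| <= 2 -> `|f x / lam k| <= (k.+1%:R ^+ 2)^-1 / 8.
Proof.
move=> fx; have p16 := pi4_ge.
have l0 := ltW (lam_gt0 k); rewrite normrM [X in _ * X]ger0_norm ?invr_ge0//.
have -> : (lam k)^-1 = (4 * pi ^+ 2)^-1 / k.+1%:R ^+ 2 by rewrite -invfM.
rewrite mulrA [X in _ <= X]mulrC ler_wpM2r ?invr_ge0 ?sqr_ge0//.
rewrite ler_pdivrMr; lra.
Qed.

Lemma cvg_phi_series f t : (forall x, `|f x| <= 2) ->
  cvgn (series (fun k => f (lam k * t) / lam k)).
Proof.
move=> f2; apply: (@cvg_series_bounded _ 1) => n.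
apply: (@le_trans _ _ (\sum_(k < n) (k.+1%:R ^+ 2)^-1 / 8)).
  by apply: ler_sum => k _; exact: norm_term_le.
rewrite -mulr_suml; have := sum_inv_sqr_le n.
have : 0 <= n.+1%:R^-1 :> R by rewrite invr_ge0.
by move: (\sum_(_ < _) _) (n.+1%:R^-1 : R) => a b; lra.
Qed.

(** Passes to zero-based series: the upper limit moves by one, which leaves the limit unchanged. The
    bound 2 on [f] serves both [sin] and [1 - cos]. *)
Lemma phi_seriesE f t (g : R -> R -> R) : (forall x, `|f x| <= 2) ->
  (forall k, g k.+1%:R t = f (lam k * t) / lam k) ->
  limn (fun n => \sum_(1 <= k < n) g k%:R t) =
  limn (series (fun k => f (lam k * t) / lam k)).
Proof.
move=> f2 h; apply/cvg_lim => //; rewrite -cvg_shiftS.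
rewrite (_ : (fun n => _) = series (fun k => f (lam k * t) / lam k)); first exact: cvg_phi_series.
apply/funext => n /=.
by rewrite /series/= big_add1/=; apply: eq_bigr => k _; exact: h.
Qed.

Lemma norm_sin_le2 x : `|sin x| <= 2 :> R.
Proof. by have := sin_max x; lra. Qed.

Lemma norm_cos_le2 x : `|1 - cos x| <= 2 :> R.
Proof. by have := cos_max x; rewrite !ler_norml; lra. Qed.

Lemma phi_reE t : phi_re t = 2 * limn (series (fun k => (1 - cos (lam k * t)) / lam k)).
Proof. by rewrite /phi_re (@phi_seriesE (fun x => 1 - cos x) t (fun k t =>
  (1 - cos (4 * pi ^+ 2 * k ^+ 2 * t)) / (4 * pi ^+ 2 * k ^+ 2)) norm_cos_le2). Qed.

Lemma phi_imE t : phi_im t = t + 2 * limn (series (fun k => sin (lam k * t) / lam k)).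
Proof. by rewrite /phi_im (@phi_seriesE sin t (fun k t =>
  sin (4 * pi ^+ 2 * k ^+ 2 * t) / (4 * pi ^+ 2 * k ^+ 2)) norm_sin_le2). Qed.

Lemma lim_phi_diff_le f (t t' B : R) q : (forall x, `|f x| <= 2) ->
  (forall n, (q <= n)%N ->
    `|\sum_(k < n) (f (lam k * t) / lam k - f (lam k * t') / lam k)| <= B) ->
  `|limn (series (fun k => f (lam k * t) / lam k)) -
    limn (series (fun k => f (lam k * t') / lam k))| <= B.
Proof.
move=> f2 h; pose u t k := f (lam k * t) / lam k.
have cu s : cvgn (series (u s)) by exact: cvg_phi_series.
have e : series (u t) - series (u t') = series (u t - u t') by rewrite seriesD seriesN.
rewrite -/(u t) -/(u t') -(limB (cu t) (cu t')) -/(series (u t) - series (u t')) e.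
apply: lim_series_norm_le h; rewrite -e; exact: is_cvgB.
Qed.

Section Approximation.
Variables (q : nat) (p : int) (q0 : (0 < q)%N) (pq : coprimez p q).

(* |sum_(k <= n) exp(2 pi i x k^2)| <= n * weylC for n >= q and x within 1/q^2 of p/q *)
Definition weylC : R := 7 * Num.sqrt (harm q / q%:R).

(** Lets the linear summand [t] of the imaginary part, which moves by at most 1/(4q^2), be absorbed
    into [weylC / q]. *)
Lemma weylC_ge : (4 * q%:R)^-1 <= weylC.
Proof.
have hq := @harm_ge1 R q q0.
have qR : 0 < q%:R :> R by rewrite ltr0n.
have q1 : 1 <= q%:R :> R by rewrite ler1n.
have : q%:R^-1 <= Num.sqrt (harm q / q%:R) :> R.
  rewrite -[X in X <= _]ger0_norm ?invr_ge0// -sqrtr_sqr ler_sqrt.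
    rewrite expr2 ler_wpM2r// ?invr_ge0//; apply: le_trans hq; by rewrite invf_le1.
  by rewrite divr_ge0//; lra.
rewrite /weylC invfM; have : 0 <= q%:R^-1 :> R by rewrite invr_ge0.
by move: (q%:R^-1 : R) (Num.sqrt _) => a b; lra.
Qed.

Lemma weyl_near (c : R) n : (q <= n)%N -> `|2 * pi * c - p%:~R / q%:R| <= (q%:R ^+ 2)^-1 ->
  `|\sum_(k < n) cos (lam k * c)| <= n%:R * weylC /\
  `|\sum_(k < n) sin (lam k * c)| <= n%:R * weylC.
Proof.
move=> qn hc; have := @weyl_sum_cos_sin R n q p (2 * pi * c) _ pq hc.
rewrite q0 qn => /(_ isT).
have e (g : R -> R) : \sum_(k < n) g (2 * pi * (2 * pi * c) * k.+1%:R ^+ 2) =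
    \sum_(k < n) g (lam k * c).
  by apply: eq_bigr => k _; congr (g _); rewrite /lam; ring.
by rewrite (e cos) (e sin).
Qed.

(** The real part moves by at most 2 and the imaginary part by at most 3 times [weylC / q], and 4 +
    9 is below 25. *)
Lemma phi_near (t : R) : let t0 := p%:~R / q%:R / (2 * pi) in
  `|2 * pi * t - p%:~R / q%:R| <= (q%:R ^+ 2)^-1 ->
  dist2 (phi t) (phi t0) <= 5 * (weylC / q%:R).
Proof.
move=> t0 ht; have p2 := @pi_ge2 R; have wC := weylC_ge.
have qR : 0 < q%:R :> R by rewrite ltr0n.
have t0E : p%:~R / q%:R = 2 * pi * t0 by rewrite /t0 [RHS]mulrC divfK// gt_eqF//; lra.
have tt0 : 2 * pi * `|t - t0| <= (q%:R ^+ 2)^-1.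
  have -> : 2 * pi * `|t - t0| = `|2 * pi * t - p%:~R / q%:R|; last by [].
  by rewrite t0E -mulrBr normrM [`|2 * pi|]ger0_norm//; lra.
(* Every point at least as close to [t0] as [t] satisfies the same approximation, so the Weyl bounds
   hold at all mean value points. *)
have near c : `|c - t0| <= `|t - t0| -> `|2 * pi * c - p%:~R / q%:R| <= (q%:R ^+ 2)^-1.
  move=> hc; apply: le_trans tt0.
  by rewrite t0E -mulrBr normrM [`|2 * pi|]ger0_norm ?ler_wpM2l//; lra.
have w0 : 0 <= weylC by rewrite mulr_ge0 ?sqrtr_ge0.
have wq0 : 0 <= weylC / q%:R by rewrite divr_ge0.
have tt1 : `|t - t0| <= (q%:R ^+ 2)^-1 / 4.
  by have := normr_ge0 (t - t0); move: tt0; set a := _^-1; nra.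
have W1 : `|t - t0| * (q%:R * weylC) <= weylC / q%:R / 4.
  apply: (@le_trans _ _ ((q%:R ^+ 2)^-1 / 4 * (q%:R * weylC))).
    by rewrite ler_wpM2r// mulr_ge0.
  suff -> : (q%:R ^+ 2)^-1 / 4 * (q%:R * weylC) = weylC / q%:R / 4 by [].
  by field; rewrite gt_eqF.
have W2 : `|t - t0| <= weylC / q%:R.
  apply: (le_trans tt1); rewrite expr2 invfM -mulrA mulrC ler_wpM2r ?invr_ge0//.
  by move: wC; rewrite invfM mulrC.
have hs n : (q <= n)%N ->
   `|\sum_(k < n) (sin (lam k * t) / lam k - sin (lam k * t0) / lam k)| <= weylC / q%:R.
  move=> qn; have qn' : (0 < q <= n)%N by rewrite q0.
  have := @partial_diff_le sin cos weylC t0 t q n qn' (@is_derive_sin R)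
    (fun c hc => (weyl_near (leqnn _) (near c hc)).1)
    (fun c m hc qm => (weyl_near qm (near c hc)).2).
  move=> /le_trans; apply; apply: (le_trans (lerD W1 (lexx _))).
  by move: (weylC / q%:R) wq0 => a a0; lra.
have hc n : (q <= n)%N ->
   `|\sum_(k < n) ((1 - cos (lam k * t)) / lam k - (1 - cos (lam k * t0)) / lam k)| <= weylC / q%:R.
  move=> qn; have qn' : (0 < q <= n)%N by rewrite q0.
  have hsin c : `|c - t0| <= `|t - t0| -> `|\sum_(k < q) - sin (lam k * c)| <= q%:R * weylC.
    by move=> hc; rewrite sumrN normrN; exact: (weyl_near (leqnn _) (near c hc)).2.
  have := @partial_diff_le cos (fun x => - sin x) weylC t0 t q n qn' (@is_derive_cos R) hsin
    (fun c m hc qm => (weyl_near qm (near c hc)).1).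
  rewrite -normrN -sumrN; under eq_bigr => k _.
    have -> : - (cos (lam k * t) / lam k - cos (lam k * t0) / lam k) =
      (1 - cos (lam k * t)) / lam k - (1 - cos (lam k * t0)) / lam k by ring.
  over.
  move=> /le_trans; apply; apply: (le_trans (lerD W1 (lexx _))).
  by move: (weylC / q%:R) wq0 => a a0; lra.
have im : `|phi_im t - phi_im t0| <= 3 * (weylC / q%:R).
  rewrite !phi_imE; have := lim_phi_diff_le norm_sin_le2 hs.
  set a := limn _; set b := limn _; move=> ab.
  have -> : t + 2 * a - (t0 + 2 * b) = (t - t0) + 2 * (a - b) by ring.
  apply: (le_trans (ler_normD _ _)); rewrite normrM ger0_norm//.
  by move: ab W2; set d := weylC / _; lra.
have re : `|phi_re t - phi_re t0| <= 2 * (weylC / q%:R).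
  rewrite !phi_reE; have := lim_phi_diff_le norm_cos_le2 hc.
  by rewrite -mulrBr normrM ger0_norm// => h; rewrite ler_wpM2l.
rewrite /dist2 /phi/=; set d := weylC / q%:R in im re *.
have d0 : 0 <= d by rewrite divr_ge0.
rewrite -[X in _ <= X]ger0_norm ?mulr_ge0// -sqrtr_sqr ler_sqrt ?sqr_ge0//.
have h1 : (phi_re t - phi_re t0) ^+ 2 <= (2 * d) ^+ 2.
  by rewrite -[X in X <= _]real_normK ?num_real// ler_sqr ?nnegrE ?mulr_ge0.
have h2 : (phi_im t - phi_im t0) ^+ 2 <= (3 * d) ^+ 2.
  by rewrite -[X in X <= _]real_normK ?num_real// ler_sqr ?nnegrE ?mulr_ge0.
nra.
Qed.

End Approximation.

End Series.

(** * The lower bound *)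

Section LowerBound.
Context {R : realType}.

Lemma norm_sinB_le (a b : R) : `|sin a - sin b| <= `|a - b|.
Proof.
wlog ab : a b / b <= a => [h|].
  by have [/h//|/ltW/h] := leP b a; rewrite distrC [`|b - a|]distrC.
have [c _ ->] := MVT_derive ab (@is_derive_sin R).
by rewrite normrM ler_piMl// cos_max.
Qed.

Lemma sum_inv_sqr_tail K n : (0 < K)%N ->
  \sum_(K <= k < n) (k.+1%:R ^+ 2)^-1 <= K%:R^-1 :> R.
Proof.
move=> K0; have [nK|Kn] := leqP n K; first by rewrite big_geq// invr_ge0.
suff h d : \sum_(K <= k < K + d) (k.+1%:R ^+ 2)^-1 <= K%:R^-1 - (K + d)%:R^-1 :> R.
  have := h (n - K)%N; rewrite subnKC 1?ltnW// => /le_trans; apply.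
  by rewrite gerBl invr_ge0.
elim: d => [|d ih]; first by rewrite addn0 big_geq// subrr.
rewrite addnS big_nat_recr ?leq_addr//=.
have m0 : 0 < (K + d)%:R :> R by rewrite ltr0n addn_gt0 K0.
set m := (K + d)%N in ih m0 *.
have h : (m.+1%:R ^+ 2)^-1 <= m%:R^-1 - m.+1%:R^-1 :> R.
  have -> : m%:R^-1 - m.+1%:R^-1 = (m%:R * m.+1%:R)^-1 :> R.
    by rewrite -[m.+1%:R]natr1; field; apply/andP; split; lra.
  rewrite lef_pV2 ?posrE ?mulr_gt0 ?exprn_gt0// expr2 ler_wpM2r// -natr1; lra.
by apply: (le_trans (lerD ih h)); rewrite addrA subrK.
Qed.

(** Each of the first [K] terms is 1-Lipschitz, since the frequency equals the denominator; the
    remaining terms are bounded absolutely. *)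
Lemma phi_im_diff_le K (t s : R) : (0 < K)%N ->
  `|phi_im t - phi_im s| <= (2 * K%:R + 1) * `|t - s| + K%:R^-1.
Proof.
move=> K0.
have h n : (K <= n)%N ->
  `|\sum_(k < n) (sin (lam k * t) / lam k - sin (lam k * s) / lam k)| <=
   K%:R * `|t - s| + K%:R^-1 / 4.
  move=> Kn.
  rewrite -(big_mkord xpredT (fun k => sin (lam k * t) / lam k - sin (lam k * s) / lam k)).
  rewrite (big_cat_nat (leq0n K) Kn)/= big_mkord.
  apply: (le_trans (ler_normD _ _)); apply: lerD.
    apply: (le_trans (ler_norm_sum _ _ _)).
    apply: (@le_trans _ _ (\sum_(k < K) `|t - s|)).
      apply: ler_sum => k _; have l0 := @lam_gt0 R k.
      rewrite -mulrBl normrM [X in _ * X]ger0_norm ?invr_ge0 ?(ltW l0)//.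
      rewrite ler_pdivrMr//; apply: (le_trans (norm_sinB_le _ _)).
      by rewrite -mulrBr normrM ger0_norm ?(ltW l0)// mulrC.
    by rewrite sumr_const card_ord mulr_natl.
  apply: (le_trans (ler_norm_sum _ _ _)).
  apply: (@le_trans _ _ (\sum_(K <= k < n) (k.+1%:R ^+ 2)^-1 / 4)).
    apply: ler_sum => k _; apply: (le_trans (ler_normB _ _)).
    have := norm_term_le k (norm_sin_le2 (lam k * t)).
    have := norm_term_le k (norm_sin_le2 (lam k * s)).
    by move: ((k.+1%:R ^+ 2)^-1 : R) => a; lra.
  by rewrite -mulr_suml ler_wpM2r// sum_inv_sqr_tail.
have := lim_phi_diff_le (@norm_sin_le2 R) h.
rewrite !phi_imE; set a := limn _; set b := limn _ => ab.
have -> : t + 2 * a - (s + 2 * b) = (t - s) + 2 * (a - b) by ring.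
apply: (le_trans (ler_normD _ _)); rewrite normrM [`|2|]ger0_norm//.
have : 0 <= K%:R^-1 :> R by rewrite invr_ge0.
by move: (K%:R^-1 : R) ab => c ab c0; lra.
Qed.

Lemma phi_im_continuous : continuous (@phi_im R).
Proof.
move=> t; apply/cvgrPdist_le => /= e e0.
pose K := (Num.truncn (2 / e)).+1.
have K0 : 0 < K%:R :> R by [].
have Ke : K%:R^-1 <= e / 2.
  rewrite -[e / 2]invrK lef_pV2 ?posrE ?invr_gt0 ?divr_gt0// invf_div.
  by rewrite ltW// truncnS_gt.
near=> s.
have ts : `|t - s| <= e / 2 / (2 * K%:R + 1).
  near: s; apply: cvgr_dist_le => //; rewrite divr_gt0 ?divr_gt0//; lra.
apply: (le_trans (@phi_im_diff_le K t s isT)).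
have h : (2 * K%:R + 1) * `|t - s| <= e / 2.
  by rewrite mulrC -ler_pdivlMr//; lra.
by rewrite [leRHS](splitr e); exact: lerD.
Unshelve. all: by end_near. Qed.

Lemma norm_phi_imB_le (t : R) : `|phi_im t - t| <= 1.
Proof.
have h n : (0 <= n)%N -> `|\sum_(k < n) (sin (lam k * t) / lam k)| <= 2^-1.
  move=> _; apply: (le_trans (ler_norm_sum _ _ _)).
  apply: (@le_trans _ _ (\sum_(k < n) (k.+1%:R ^+ 2)^-1 / 8)).
    by apply: ler_sum => k _; exact: (norm_term_le k (norm_sin_le2 _)).
  rewrite -mulr_suml; have := @sum_inv_sqr_le R n.
  have : 0 <= n.+1%:R^-1 :> R by rewrite invr_ge0.
  by move: (\sum_(_ < _) _) (n.+1%:R^-1 : R) => a b; lra.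
have := lim_series_norm_le (@cvg_phi_series R sin t (@norm_sin_le2 R)) h.
by rewrite phi_imE addrAC subrr add0r normrM ger0_norm//; lra.
Qed.

(** [phi_im] is within 1 of the identity, so its values at -2 and 2 enclose [0, 1]. *)
Lemma phi_im_onto01 (v : R) : 0 <= v <= 1 -> exists t, phi_im t = v.
Proof.
move=> /andP[v0 v1].
have h2 := norm_phi_imB_le 2; have hN2 := norm_phi_imB_le (-2).
rewrite !ler_norml in h2 hN2.
have fa : phi_im (-2) <= v by lra.
have fb : v <= phi_im 2 by lra.
have [|||t _ <-] := @IVT R (@phi_im R) (-2) 2 v; last by exists t.
- lra.
- by apply: continuous_subspaceT => x; exact: phi_im_continuous.
- by rewrite ge_min fa/= le_max fb orbT.
Qed.

Lemma dist2_le_diam (U : set (pt R)) x y : U x -> U y -> ((dist2 x y)%:E <= diam U)%E.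
Proof. by move=> Ux Uy; apply: ereal_sup_ubound; exists x => //; exists y. Qed.

Lemma dist2_ge0 (x y : pt R) : 0 <= dist2 x y.
Proof. exact: sqrtr_ge0. Qed.

Lemma dist2_ge_snd (x y : pt R) : `|x.2 - y.2| <= dist2 x y.
Proof.
rewrite /dist2 -sqrtr_sqr ler_sqrt ?lerDr ?sqr_ge0//.
by rewrite addr_ge0 ?sqr_ge0.
Qed.

Lemma diam_fin (U : set (pt R)) x (B : R) : U x -> (diam U <= B%:E)%E ->
  diam U = (fine (diam U))%:E /\ 0 <= fine (diam U) <= B.
Proof.
move=> Ux UB.
have d0 : (0 <= diam U)%E.
  by apply: le_trans (dist2_le_diam Ux Ux); rewrite lee_fin dist2_ge0.
have fin : diam U \is a fin_num.
  by rewrite ge0_fin_numE//; apply: le_lt_trans UB _; rewrite ltry.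
have e : diam U = (fine (diam U))%:E by rewrite fineK.
by split => //; rewrite -!lee_fin -e d0.
Qed.

Lemma hterm_ge0 s (U : set (pt R)) : (0 <= hterm s U)%E.
Proof. by rewrite /hterm; case: (pselect (U = set0)) => u //; rewrite lee_fin powR_ge0. Qed.

Lemma sum_hterm_cover_ge (s : R) (U : nat -> set (pt R)) : 0 <= s <= 1 ->
  delta_cover 1 (range (@phi R)) U ->
  ((2^-1)%:E <= \sum_(0 <= i <oo) hterm s (U i))%E.
Proof.
move=> /andP[s0 s1] [cov small].
(* The projection of a nonempty [U i] lies within its diameter of the second coordinate of any
   chosen point. This interval has twice the diameter as length, whence the factor 2 in [muJ]. *)
pose J i : set R := if pselect (exists x, U i x) is left e then
  `[(projT1 (cid e)).2 - fine (diam (U i)), (projT1 (cid e)).2 + fine (diam (U i))]%classic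
  else set0.
have mJ i : measurable (J i) by rewrite /J; case: pselect.
have cJ : `[0, 1]%classic `<=` \bigcup_i J i.
  move=> v; rewrite /= in_itv/= => /phi_im_onto01[t tv].
  have [|i _ Ui] := cov (phi t); first by exists t.
  exists i => //; rewrite /J; case: pselect => [e|]; last by case; exists (phi t).
  case: (cid e) => x Ux /=; rewrite in_itv/= -ler_distl.
  have [dE _] := diam_fin Ux (small i).
  rewrite -tv -lee_fin -dE; apply: le_trans (dist2_le_diam Ui Ux).
  by rewrite lee_fin; exact: (dist2_ge_snd (phi t) x).
have muJ i : (lebesgue_measure (J i) <= 2%:E * hterm s (U i))%E.
  rewrite /J; case: pselect => [e|_]; last by rewrite measure0 mule_ge0// hterm_ge0.
  case: (cid e) => x Ux /=; rewrite /hterm; case: (pselect (U i = set0)) => U0.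
    by exfalso; rewrite U0 in Ux.
  have [dE /andP[d0 d1]] := diam_fin Ux (small i).
  set d := fine (diam (U i)) in d0 d1 *.
  rewrite lebesgue_measure_itv/= lte_fin; case: ifPn => [_|_]; last first.
    by rewrite mule_ge0// lee_fin powR_ge0.
  rewrite -EFinB lee_fin.
  have -> : x.2 + d - (x.2 - d) = 2 * d by ring.
  (* For a diameter in (0, 1] and [s <= 1], the power [d ^ s] dominates [d]; diameter 0 is treated
     apart. *)
  rewrite ler_wpM2l//; have [->|dn0] := eqVneq d 0; first exact: powR_ge0.
  by apply: ger1_powR => //; rewrite d1 andbT lt_neqAle eq_sym dn0.
have h1 : (lebesgue_measure (`[0%R, 1%R]%classic : set R) <=
    \sum_(0 <= i <oo) lebesgue_measure (J i))%E.
  by apply: measure_sigma_subadditive.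
have h2 : (\sum_(0 <= i <oo) lebesgue_measure (J i) <=
    \sum_(0 <= i <oo) (2%:E * hterm s (U i)))%E.
  by apply: lee_nneseries => // i _ _; exact: muJ.
move: (le_trans h1 h2); rewrite lebesgue_measure_itv/= lte_fin ltr01 oppr0 adde0.
rewrite nneseriesZl//; last by move=> i _; exact: hterm_ge0.
case: (\sum_(0 <= i <oo) hterm s (U i))%E => [r| |].
- by rewrite -EFinM !lee_fin => h; lra.
- by rewrite leey.
- by rewrite mulr_infty gtr0_sg// mul1e.
Qed.

Lemma dim_phi_ge1 : (1%:E <= hausdorff_dim (range (@phi R)))%E.
Proof.
apply: le_ereal_inf_tmp => _ [s [s0 Hs] <-]; rewrite lee_fin leNgt; apply/negP => s1.
have h : ((2^-1)%:E <= hausdorff_pre s 1 (range (@phi R)))%E.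
  by apply: le_ereal_inf_tmp => _ [U cU <-]; apply: sum_hterm_cover_ge => //; rewrite s0 ltW.
have : (hausdorff_pre s 1 (range (@phi R)) <= hausdorff_measure s (range (@phi R)))%E.
  by apply: ereal_sup_ubound; exists 1 => /=.
by move=> /(le_trans h); rewrite Hs lee_fin; lra.
Qed.

End LowerBound.

(** * Diophantine approximation and p-series *)

Section Dirichlet.
Context {R : realType}.
Implicit Types (x : R) (p : int) (q : nat).

(** Two of the [Q + 1] fractional parts of [j x], for [j <= Q], fall into the same interval of
    length 1/Q; their difference gives [q] and [p]. *)
Lemma dirichlet_pigeonhole x Q : (0 < Q)%N ->
  exists p q, (0 < q <= Q)%N /\ `|q%:R * x - p%:~R| < Q%:R^-1.
Proof.
move=> Q0; have QR : 0 < Q%:R :> R by rewrite ltr0n.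
pose fr (j : nat) : R := j%:R * x - (Num.floor (j%:R * x))%:~R.
have fr0 j : 0 <= fr j by rewrite subr_ge0 floor_le.
have fr1 j : fr j < 1 by rewrite ltrBlDl -[1]/(1%:~R) -rmorphD/= floorD1_gt.
have lt j : (Num.truncn (Q%:R * fr j) < Q)%N.
  rewrite truncn_lt_nat; last by rewrite mulr_ge0.
  by rewrite -[ltRHS]mulr1 ltr_pM2l.
pose f (j : 'I_Q.+1) : 'I_Q := Ordinal (lt j).
have : ~ injective f by move=> /leq_card; rewrite !card_ord ltnn.
move=> /existsNP[i /existsNP[j /not_implyP[fij nij]]].
wlog ij : i j fij nij / (i < j)%N.
  move=> h; have [/h|/h|/val_inj //] := ltngtP i j; first exact.
  by apply; [exact/esym | exact/nesym].
exists (Num.floor (j%:R * x) - Num.floor (i%:R * x)), (j - i)%N; split.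
  by rewrite subn_gt0 ij/=; have := ltn_ord j; lia.
have -> : (j - i)%:R * x - (Num.floor (j%:R * x) - Num.floor (i%:R * x))%:~R = fr j - fr i.
  by rewrite /fr natrB ?(ltnW ij)// rmorphB/=; ring.
have /(congr1 val)/= fE := fij.
have bnd k : (Num.truncn (Q%:R * fr k))%:R <= Q%:R * fr k < (Num.truncn (Q%:R * fr k))%:R + 1.
  by rewrite natr1; apply: truncn_itv; rewrite mulr_ge0.
have /andP[i1 i2] := bnd i; have /andP[j1 j2] := bnd j.
rewrite fE in i1 i2; rewrite -[ltRHS]mul1r ltr_pdivlMr//.
rewrite -[X in _ * X]ger0_norm ?(ltW QR)// -normrM mulrC mulrBr.
by rewrite ltr_norml; apply/andP; split; lra.
Qed.

(** Dividing [p] and [q] by their gcd divides the error by it as well. *)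
Lemma dirichlet_coprime x Q : (0 < Q)%N ->
  exists p q, [/\ coprimez p q, (0 < q <= Q)%N & `|q%:R * x - p%:~R| < Q%:R^-1].
Proof.
move=> Q0; have [p [q [/andP[q0 qQ] h]]] := dirichlet_pigeonhole x Q0.
pose g := gcdn `|p| q.
have g0 : (0 < g)%N by rewrite gcdn_gt0 q0 orbT.
have gp : (g%:Z %| p)%Z by rewrite dvdzE/= dvdn_gcdl.
have gq : (g %| q)%N by rewrite dvdn_gcdr.
have pE := divzK gp; have qE := divnK gq.
set p' := (p %/ g)%Z in pE; set q' := (q %/ g)%N in qE.
have q'0 : (0 < q')%N by rewrite divn_gt0// dvdn_leq.
exists p', q'; split.
- have e : gcdn `|p'| q' = 1%N.
    apply/eqP; rewrite -(eqn_pmul2r g0) mul1n muln_gcdl qE.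
    by have -> : (`|p'| * g = `|p|)%N by rewrite -pE abszM.
  by rewrite /coprimez /gcdz/= e.
- by rewrite q'0/=; apply: leq_trans qQ; exact: leq_div.
- apply: le_lt_trans h; rewrite -[in leRHS]pE -[in leRHS]qE natrM rmorphM/=.
  have -> : q'%:R * g%:R * x - p'%:~R * g%:~R = (q'%:R * x - p'%:~R) * g%:R by ring.
  by rewrite normrM normr_nat ler_peMr// ler1n.
Qed.

(** Only finitely many denominators occur, and for each the distance of [q x] to the integers is
    attained at its floor or the next integer. This excludes small denominators in
    [dirichlet_approx]. *)
Lemma irrational_dist_gt0 x N :
  (forall p q, (0 < q)%N -> x != p%:~R / q%:R) ->
  exists2 e : R, 0 < e & forall p q, (0 < q < N)%N -> e <= `|q%:R * x - p%:~R|.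
Proof.
move=> irr; elim: N => [|N [e e0 he]]; first by exists 1 => // p q; rewrite ltn0 andbF.
have [->|N0] := posnP N; first by exists 1 => // p [|q].
pose z := N%:R * x; pose m := Num.floor z.
have NR : N%:R != 0 :> R by rewrite pnatr_eq0 -lt0n.
have zn (p : int) : z != p%:~R.
  by apply: contra_neq (irr p N N0); rewrite /z => <-; rewrite mulrC mulKf.
have zm : m%:~R < z by rewrite lt_neqAle floor_le andbT eq_sym zn.
have zm1 : z < m%:~R + 1 by rewrite -[1]/(1%:~R) -rmorphD/= floorD1_gt.
exists (Num.min e (Num.min (z - m%:~R) (m%:~R + 1 - z))).
  by rewrite !lt_min e0 !subr_gt0 zm zm1.
move=> p q /andP[q0]; rewrite ltnS leq_eqVlt => /orP[/eqP ->|qN]; last first.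
  by rewrite ge_min he ?q0.
rewrite -/z !ge_min; apply/orP; right; have [pm|pm] := leP p m.
  have : p%:~R <= m%:~R :> R by rewrite ler_int.
  by move=> h; rewrite ger0_norm; [rewrite lerD2l lerN2 h|lra].
have : m%:~R + 1 <= p%:~R :> R by rewrite -[1]/(1%:~R) -rmorphD/= ler_int lezD1.
by move=> h; rewrite ler0_norm; [apply/orP; right; lra|lra].
Qed.

Lemma dirichlet_approx x N :
  (exists p q, (0 < q)%N /\ x = p%:~R / q%:R) \/
  exists p q, [/\ coprimez p q, (0 < q)%N, (N <= q)%N &
    `|x - p%:~R / q%:R| <= (q%:R ^+ 2)^-1].
Proof.
have [[p [q h]]|irr] := pselect (exists p q, (0 < q)%N /\ x = p%:~R / q%:R).
  by left; exists p, q.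
right; have irr' p q : (0 < q)%N -> x != p%:~R / q%:R.
  by move=> q0; apply/eqP => xE; apply: irr; exists p, q.
have [e e0 he] := irrational_dist_gt0 N irr'.
(* With 1/Q below [e], a denominator under [N] would contradict the lower bound [he]. *)
pose Q := (Num.truncn e^-1).+1.
have Qe : Q%:R^-1 < e by rewrite invf_plt ?posrE ?ltr0n//; exact: truncnS_gt.
have [p [q [pq /andP[q0 qQ] h]]] := @dirichlet_coprime x Q isT.
have qR : 0 < q%:R :> R by rewrite ltr0n.
exists p, q; split => //.
  rewrite leqNgt; apply/negP => qN.
  have := he p q; rewrite q0 qN => /(_ isT) he'.
  by have := lt_trans (le_lt_trans he' h) Qe; rewrite ltxx.
have -> : x - p%:~R / q%:R = (q%:R * x - p%:~R) / q%:R by field; rewrite gt_eqF.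
rewrite normrM [X in _ * X]ger0_norm ?invr_ge0// expr2 invfM ler_wpM2r ?invr_ge0//.
apply: (le_trans (ltW h)); by rewrite lef_pV2 ?posrE// ler_nat.
Qed.

End Dirichlet.

Section PSeries.
Context {R : realType}.

(** A discrete integral test, so that the p-series telescopes: it combines ln(1 - u) <= -u for u =
    1/(n + 2) with exp v >= 1 + v. *)
Lemma powR_step (a : R) n : 0 < a ->
  a * n.+2%:R `^ (- (1 + a)) <= n.+1%:R `^ (- a) - n.+2%:R `^ (- a).
Proof.
move=> a0.
have n1 : 0 < n.+1%:R :> R by []. have n2 : 0 < n.+2%:R :> R by [].
have lnE : ln (n.+1%:R / n.+2%:R) <= - n.+2%:R^-1 :> R.
  have -> : n.+1%:R / n.+2%:R = 1 + - n.+2%:R^-1 :> R.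
    by rewrite -[n.+2%:R]natr1; move: (n.+1%:R : R) n1 => x x0; field; rewrite gt_eqF//; lra.
  apply: le_ln1Dx; rewrite ltrN2 invf_lt1//; by rewrite ltr1n.
rewrite ln_div ?posrE// in lnE.
have e1 : n.+1%:R `^ (- a) = n.+2%:R `^ (- a) * expR (a * (ln n.+2%:R - ln n.+1%:R)).
  by rewrite /powR !gt_eqF// -expRD; congr expR; ring.
rewrite e1; have e2 := expR_ge1Dx (a * (ln n.+2%:R - ln n.+1%:R) : R).
have p0 : 0 < n.+2%:R `^ (- a) :> R by rewrite powR_gt0.
have -> : n.+2%:R `^ (- (1 + a)) = n.+2%:R `^ (- a) * n.+2%:R^-1.
  by rewrite opprD addrC powRD ?powR_inv1//; rewrite pnatr_eq0/= implybT.
rewrite mulrCA -[X in _ <= _ - X]mulr1 -mulrBr ler_pM2l// lerBrDl.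
by apply: le_trans e2; rewrite lerD2l ler_wpM2l ?(ltW a0)// -lerN2 opprB.
Qed.

Lemma psum_le (a : R) N K : 0 < a -> (0 < N)%N ->
  \sum_(N.+1 <= k < K) k%:R `^ (- (1 + a)) <= a^-1 * N%:R `^ (- a).
Proof.
move=> a0 N0.
suff h d : \sum_(N.+1 <= k < N.+1 + d) k%:R `^ (- (1 + a)) <=
    a^-1 * (N%:R `^ (- a) - (N + d)%:R `^ (- a)).
  have [KN|NK] := leqP K N.+1.
    by rewrite big_geq// mulr_ge0 ?powR_ge0// invr_ge0 ltW.
  have := h (K - N.+1)%N; rewrite subnKC 1?ltnW// => /le_trans; apply.
  by rewrite ler_wpM2l ?invr_ge0 ?(ltW a0)// gerBl powR_ge0.
elim: d => [|d ih]; first by rewrite !addn0 big_geq// subrr mulr0.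
rewrite addnS big_nat_recr ?leq_addr//=.
have [m mE] : exists m, (N + d = m.+1)%N by exists (N + d).-1; lia.
rewrite addSn addnS mE in ih *.
have := powR_step m a0; rewrite -ler_pdivlMl// => h.
apply: (le_trans (lerD ih h)).
by rewrite -mulrDr addrA subrK.
Qed.

Lemma powRN_small (a e : R) : 0 < a -> 0 < e ->
  exists N, forall n, (N < n)%N -> n%:R `^ (- a) <= e.
Proof.
move=> a0 e0; pose B := e^-1 `^ a^-1.
exists (Num.truncn B) => n Bn.
have hB : B < n%:R by rewrite -truncn_lt_nat// powR_ge0.
rewrite powRN -[e]invrK lef_pV2 ?posrE ?invr_gt0 ?powR_gt0//; last first.
  by apply: le_lt_trans hB; exact: powR_ge0.
have -> : e^-1 = B `^ a by rewrite /B -powRrM mulVf ?powRr1 ?invr_ge0 ?gt_eqF ?(ltW e0).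
by apply: ge0_ler_powR => //; rewrite ?nnegrE ?powR_ge0 ?(ltW a0) ?(ltW hB).
Qed.

(** Writing 1/r as r^(-(1 + b)) r^b with r^b at most q^b leaves a convergent p-series of sum at most
    1 + 1/b; a small power thus replaces the logarithm. *)
Lemma harm_le (b : R) q : 0 < b -> (0 < q)%N -> harm q <= (1 + b^-1) * q%:R `^ b.
Proof.
move=> b0 q0.
apply: (@le_trans _ _ (\sum_(r < q) r.+1%:R `^ (- (1 + b)) * q%:R `^ b)).
  apply: ler_sum => r _.
  have -> : r.+1%:R^-1 = r.+1%:R `^ (- (1 + b)) * r.+1%:R `^ b :> R.
    rewrite -powRD; last by rewrite pnatr_eq0 implybT.
    by rewrite opprD subrK powR_inv1.
  rewrite ler_wpM2l ?powR_ge0//; apply: ge0_ler_powR; rewrite ?nnegrE ?(ltW b0)//.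
  by rewrite ler_nat.
rewrite -mulr_suml ler_wpM2r ?powR_ge0//.
rewrite -(big_mkord xpredT (fun r => r.+1%:R `^ (- (1 + b)))).
case: q q0 => // q _; rewrite big_nat_recl//= powR1 lerD2l.
have := @psum_le b 1 q.+2 b0 isT; rewrite powR1 mulr1 => h; apply: le_trans h.
by rewrite !big_add1.
Qed.

Lemma weylC_le (b : R) q : 0 < b -> (0 < q)%N ->
  @weylC R q / q%:R <= 7 * Num.sqrt (1 + b^-1) * q%:R `^ (- ((3 - b) / 2)).
Proof.
move=> b0 q0; have qR : 0 < q%:R :> R by rewrite ltr0n.
have b1 : 0 <= 1 + b^-1 by rewrite addr_ge0 ?invr_ge0 ?(ltW b0).
rewrite /weylC -!mulrA ler_wpM2l//.
have h1 : harm q / q%:R <= (1 + b^-1) * (q%:R `^ b / q%:R).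
  by rewrite mulrA ler_wpM2r ?invr_ge0//; exact: harm_le.
have h2 : Num.sqrt (harm q / q%:R) <= Num.sqrt ((1 + b^-1) * (q%:R `^ b / q%:R)) :> R.
  by apply: ler_wsqrtr.
rewrite [leRHS]sqrtrM// in h2.
have -> : q%:R `^ (- ((3 - b) / 2)) = Num.sqrt (q%:R `^ b / q%:R) / q%:R :> R.
  rewrite -powR12_sqrt; last by rewrite divr_ge0 ?powR_ge0.
  have qn0 : q%:R != 0 :> R by rewrite gt_eqF.
  have e : q%:R `^ b / q%:R = q%:R `^ (b - 1) :> R.
    by rewrite powRD ?qn0 ?implybT// powR_inv1.
  rewrite e -powRrM -[X in _ = _ * X]powR_inv1// -powRD ?qn0 ?implybT//.
  by congr powR; field.
by rewrite mulrA ler_wpM2r ?invr_ge0.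
Qed.

End PSeries.

(** * The upper bound *)

Section Counting.
Context {R : realType}.

Lemma size_int_le (S : seq int) (Y : R) : 0 <= Y -> uniq S ->
  (forall p, p \in S -> `|p|%N%:R <= Y) -> (size S)%:R <= 2 * Y + 1.
Proof.
move=> Y0 uS SY; pose m := Num.truncn Y.
have mY : m%:R <= Y by rewrite truncn_le.
have : (size S <= size [seq (i%:Z - m%:Z)%R | i <- iota 0 (2 * m).+1])%N.
  apply: uniq_leq_size => // p pS.
  have pm : (`|p| <= m)%N by rewrite truncn_ge_nat// SY.
  apply/mapP; exists (absz (p + m%:Z)%R); last by lia.
  by rewrite mem_iota/=; lia.
rewrite size_map size_iota => h.
have : (size S)%:R <= (2 * m).+1%:R :> R by rewrite ler_nat.
by rewrite -natr1 natrM; lra.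
Qed.

(** Grouping by denominator, each [q] admits at most [2 * Y q + 1] numerators; [K] exceeds every
    denominator in the finite list. *)
Lemma sum_pairs_le (S : seq (int * nat)) (c Y : nat -> R) (N : nat) : uniq S ->
  (forall q, 0 <= c q) -> (forall q, 0 <= Y q) ->
  exists K, \sum_(x <- S | (N <= x.2)%N && (`|x.1|%N%:R <= Y x.2)) c x.2 <=
    \sum_(N <= q < K) (2 * Y q + 1) * c q.
Proof.
move=> uS c0 Y0; pose K := (\max_(x <- S) x.2).+1; exists K.
have SK x : x \in S -> (x.2 < K)%N by move=> xS; rewrite ltnS; exact: leq_bigmax_seq.
pose P x := (N <= x.2)%N && (`|x.1|%N%:R <= Y x.2).
have -> : \sum_(x <- S | P x) c x.2 = \sum_(x <- S | P x) \sum_(N <= q < K | q == x.2) c q.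
  rewrite big_seq_cond [RHS]big_seq_cond; apply: eq_bigr => x /andP[xS /andP[Nx _]].
  by rewrite big_nat1_eq Nx SK.
rewrite (exchange_big_dep xpredT)//=; apply: ler_sum => q _.
rewrite big_const_seq iter_addr addr0 -[c q *+ _]mulr_natl ler_wpM2r//.
rewrite -size_filter -(size_map fst); apply: size_int_le => //.
  rewrite map_inj_in_uniq ?filter_uniq// => -[p1 q1] [p2 q2]/=.
  by rewrite !mem_filter/= => /andP[/andP[_ /eqP <-] _] /andP[/andP[_ /eqP <-] _] ->.
move=> p /mapP[[p' q']]; rewrite mem_filter/= => /andP[/andP[/andP[_ h] /eqP qq] _] ->.
by rewrite qq.
Qed.

Lemma sum_pmap (T : Type) (I : eqType) (f : I -> option T) (g : T -> R) (l : seq I) :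
  \sum_(n <- l) oapp g 0 (f n) = \sum_(x <- pmap f l) g x.
Proof.
elim: l => [|n l ih]; first by rewrite !big_nil.
by rewrite big_cons ih /=; case: (f n) => [x|] /=; rewrite ?big_cons// add0r.
Qed.

End Counting.

(** * Distances and diameters in the plane *)

Section Diameter.
Context {R : realType}.

Lemma dist2_ge_fst (x y : pt R) : `|x.1 - y.1| <= dist2 x y.
Proof.
rewrite /dist2 -sqrtr_sqr ler_sqrt ?lerDl ?sqr_ge0//.
by rewrite addr_ge0 ?sqr_ge0.
Qed.

Lemma dist2_le_norms (x y : pt R) : dist2 x y <= `|x.1 - y.1| + `|x.2 - y.2|.
Proof.
rewrite /dist2 -[leRHS]ger0_norm ?addr_ge0// -sqrtr_sqr ler_sqrt ?sqr_ge0//.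
rewrite [leRHS]sqrrD !real_normK ?num_real//.
have : 0 <= `|x.1 - y.1| * `|x.2 - y.2| by rewrite mulr_ge0.
by rewrite mulr2n; lra.
Qed.

(* the constant 2 saves the triangle inequality for the Euclidean distance *)
Lemma dist2_le_center (x y z : pt R) : dist2 x y <= 2 * (dist2 x z + dist2 y z).
Proof.
apply: (le_trans (dist2_le_norms x y)).
have := ler_distD z.1 x.1 y.1; have := ler_distD z.2 x.2 y.2.
rewrite [`|z.1 - _|]distrC [`|z.2 - _|]distrC.
have := dist2_ge_fst x z; have := dist2_ge_fst y z.
have := dist2_ge_snd x z; have := dist2_ge_snd y z.
lra.
Qed.

Lemma dist2_xx (x : pt R) : dist2 x x = 0.
Proof. by rewrite /dist2 !subrr expr0n/= addr0 sqrtr0. Qed.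

Lemma diam_le (U : set (pt R)) (B : R) :
  (forall x y, U x -> U y -> dist2 x y <= B) -> (diam U <= B%:E)%E.
Proof.
by move=> h; apply: ge_ereal_sup => _ [x Ux [y Uy <-]]; rewrite lee_fin h.
Qed.

Lemma hterm_le (s B : R) (U : set (pt R)) : 0 <= s ->
  (forall x y, U x -> U y -> dist2 x y <= B) -> (hterm s U <= (B `^ s)%:E)%E.
Proof.
move=> s0 h; rewrite /hterm; case: (pselect (U = set0)) => U0.
  by rewrite lee_fin powR_ge0.
have [x Ux] : exists x, U x by apply/set0P/eqP.
have [_ /andP[d0 dB]] := diam_fin Ux (diam_le h).
by rewrite lee_fin; apply: ge0_ler_powR; rewrite ?nnegrE// (le_trans d0).
Qed.

End Diameter.

Section UpperBound.
Context {R : realType}.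

(** The constant is 2 (5 + 5) 7, from [dist2_le_center], two uses of [phi_near], and [weylC_le]. *)
Lemma phi_near_pair (b t t' : R) (p : int) q : 0 < b -> (0 < q)%N -> coprimez p q ->
  `|2 * pi * t - p%:~R / q%:R| <= (q%:R ^+ 2)^-1 ->
  `|2 * pi * t' - p%:~R / q%:R| <= (q%:R ^+ 2)^-1 ->
  dist2 (phi t) (phi t') <= 140 * Num.sqrt (1 + b^-1) * q%:R `^ (- ((3 - b) / 2)).
Proof.
move=> b0 q0 pq ht ht'.
have h1 := phi_near q0 pq ht; have h2 := phi_near q0 pq ht'.
have h3 := weylC_le b0 q0.
apply: (le_trans (dist2_le_center _ _ _)); apply: (le_trans (ler_wpM2l _ (lerD h1 h2))) => //.
by move: (weylC q / _) h3 => w; rewrite -!mulrA; lra.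
Qed.

(** * Covers of the image for a fixed exponent above 4/3 *)

Section Cover.
Variables (s : R) (s43 : 4 / 3 < s).

(** [D] is the room that [s > 4/3] leaves. A quarter pays for the growth of the numerators ([eta]),
    a quarter for the harmonic factor ([b * s / 2]), and the remaining half [a] makes the series
    over [q] converge. *)
Let D := 3 / 2 * s - 2.
Let eta := D / 4.
Let b := D / (2 * s).
Let E := 140 * Num.sqrt (1 + b^-1).
Let e := (3 - b) / 2.
Let a := D / 2.

Let s0 : 0 < s. Proof. by move: s43; lra. Qed.
Let D0 : 0 < D. Proof. by rewrite /D; move: s43; lra. Qed.
Let b0 : 0 < b. Proof. by rewrite divr_gt0// mulr_gt0. Qed.
Let e1 : 1 < e.
Proof.
have : b < 1.
  rewrite /b ltr_pdivrMr ?mulr_gt0// mul1r /D.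
  by move: s0; lra.
by rewrite /e; move: b => b'; lra.
Qed.
Let a0 : 0 < a. Proof. by rewrite divr_gt0. Qed.
Let eta0 : 0 < eta. Proof. by rewrite divr_gt0. Qed.
Let E0 : 0 <= E. Proof. by rewrite mulr_ge0 ?sqrtr_ge0. Qed.
Let exponentE : 1 + eta - e * s = - (1 + a).
Proof. by rewrite /e /eta /a /b /D; field; rewrite gt_eqF. Qed.

(** The bound on the numerator leaves finitely many fractions per denominator, yet any fixed real
    number meets it once [q] is large. *)
Definition good N (x : int * nat) : bool :=
  [&& (N <= x.2)%N, coprimez x.1 x.2 & `|x.1|%N%:R <= x.2%:R `^ (1 + eta)].

(* balls about the fractions of large denominator, and single points otherwise *)
Definition piece N (x : int * nat) : set (pt R) :=
  [set phi t | t in [set t | `|2 * pi * t - x.1%:~R / x.2%:R| <=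
     if good N x then (x.2%:R ^+ 2)^-1 else 0]].

(** The pairs are enumerated through their codes; a number that codes no pair gives the empty set,
    of cost 0. *)
Definition pieces N (n : nat) : set (pt R) := oapp (piece N) set0 (pickle_inv n).

Lemma pieces_cover N : range (@phi R) `<=` \bigcup_n pieces N.+1 n.
Proof.
move=> _ [t _ <-]; pose x := 2 * pi * t.
suff [pq h] : exists pq, piece N.+1 pq (phi t).
  by exists (pickle pq) => //; rewrite /pieces pickleK_inv.
have x0 : 0 < `|x| + 1 by rewrite ltr_wpDl.
have x1 : 0 < (`|x| + 1)^-1 by rewrite invr_gt0.
(* Beyond [M] the power q^eta exceeds |x| + 1, which bounds |p/q|; hence |p| is at most q^(1 +
   eta). *)
have [M hM] := powRN_small eta0 x1.
have [[p [q [q0 xE]]]|[p [q [pq q0 Nq xpq]]]] := dirichlet_approx x (maxn N.+1 M.+1).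
  exists (p, q), t => //=; rewrite -/x xE subrr normr0.
  by case: ifP => // _; rewrite invr_ge0 sqr_ge0.
exists (p, q), t => //=.
rewrite geq_max in Nq; case/andP: Nq => Nq Mq.
suff -> : good N.+1 (p, q) by [].
rewrite /good/= Nq pq/=.
have qR : 0 < q%:R :> R by rewrite ltr0n.
have q1 : 1 <= q%:R :> R by rewrite ler1n.
have qeta : `|x| + 1 <= q%:R `^ eta.
  by have := hM q Mq; rewrite powRN lef_pV2 ?posrE ?powR_gt0.
have px : `|p%:~R / q%:R| <= `|x| + 1.
  have -> : p%:~R / q%:R = x - (x - p%:~R / q%:R) by ring.
  apply: (le_trans (ler_normB _ _)); rewrite lerD2l; apply: (le_trans xpq).
  by rewrite invf_le1 ?exprn_gt0// exprn_ege1.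
rewrite powRD; last by rewrite (gt_eqF qR) implybT.
rewrite powRr1 ?ler0n// mulrC -ler_pdivrMr//; apply: le_trans qeta; apply: le_trans px.
by rewrite normrM [`|q%:R^-1|]ger0_norm ?invr_ge0// ler_wpM2r ?invr_ge0// -intr_norm pmulrn abszE.
Qed.

Lemma piece_dist_le N x u v : piece N.+1 x u -> piece N.+1 x v ->
  dist2 u v <= if good N.+1 x then E * x.2%:R `^ (- e) else 0.
Proof.
case: x => p q [t ht <-] [t' ht' <-]; move: ht ht' => /=.
case: ifPn => [/and3P[/= Nq pq _] ht ht'|_ ht ht'].
  by apply: (phi_near_pair b0 _ pq ht ht'); exact: leq_trans Nq.
rewrite !normr_le0 !subr_eq0 in ht ht'.
have -> : t = t'.
  have p2 : 2 * pi != 0 :> R by rewrite gt_eqF// mulr_gt0// pi_gt0.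
  by apply: (mulfI p2); rewrite (eqP ht) (eqP ht').
by rewrite dist2_xx.
Qed.

Lemma hterm_piece_le N x : (hterm s (piece N.+1 x) <=
  (if good N.+1 x then E `^ s * x.2%:R `^ (- (e * s)) else 0)%:E)%E.
Proof.
apply: (le_trans (hterm_le (ltW s0) (@piece_dist_le N x))).
(* As [s] is positive, 0 to the power [s] is 0: the countably many single points cost nothing. *)
rewrite lee_fin; case: ifP => _; last by rewrite powR0// gt_eqF.
by rewrite powRM ?powR_ge0// -powRrM mulNr.
Qed.

(** The codes in a partial sum decode to a duplicate-free list of pairs, which [sum_pairs_le] groups
    by denominator. By [exponentE] the result is the tail of a p-series with exponent 1 + a. *)
Lemma sum_hterm_pieces_le N : (0 < N)%N ->
  (\sum_(0 <= n <oo) hterm s (pieces N.+1 n) <=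
    (3 * E `^ s * (a^-1 * N%:R `^ (- a)))%:E)%E.
Proof.
move=> N0; pose c q : R := E `^ s * q%:R `^ (- (e * s)).
have c0 q : 0 <= c q by rewrite mulr_ge0 ?powR_ge0.
pose g (x : int * nat) : R := if good N.+1 x then c x.2 else 0.
apply: lime_le; first by apply: is_cvg_nneseries => n _ _; exact: hterm_ge0.
apply: nearW => M.
apply: (@le_trans _ _ (\sum_(0 <= n < M) (oapp g 0 (pickle_inv n))%:E)%E).
  apply: lee_sum => n _; rewrite /pieces; case: (pickle_inv n) => [x|]/=.
    exact: hterm_piece_le.
  by rewrite /hterm; case: (pselect _).
rewrite sumEFin lee_fin /index_iota subn0 sum_pmap.
set S := pmap _ _; have uS : uniq S.
  by apply: (pmap_uniq (@pickle_invK (int * nat)%type)); exact: iota_uniq.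
have [K hK] := @sum_pairs_le R S c (fun q => q%:R `^ (1 + eta)) N.+1 uS c0 (fun q => powR_ge0 _ _).
apply: (@le_trans _ _ (\sum_(x <- S | (N.+1 <= x.2)%N && (`|x.1|%N%:R <= x.2%:R `^ (1 + eta))) c x.2)).
  rewrite [leRHS]big_mkcond; apply: ler_sum => x _; rewrite /g.
  case: ifPn => [/and3P[-> _ ->]//|_]; by case: ifP.
apply: (le_trans hK).
apply: (@le_trans _ _ (\sum_(N.+1 <= q < K) 3 * E `^ s * q%:R `^ (- (1 + a)))).
  rewrite big_nat_cond [leRHS]big_nat_cond; apply: ler_sum => q /andP[/andP[Nq _] _].
  have q0 : 0 < q%:R :> R by rewrite ltr0n (leq_trans _ Nq).
  (* Hence the count 2 q^(1 + eta) + 1 is at most 3 q^(1 + eta), the source of the factor 3. *)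
  have q1 : 1 <= q%:R `^ (1 + eta) :> R.
    rewrite -[leLHS](powRr0 q%:R); apply: ler_powR; last by rewrite addr_ge0 ?(ltW eta0).
    by rewrite ler1n (leq_trans _ Nq).
  rewrite -exponentE [in leRHS]powRD; last by rewrite (gt_eqF q0) implybT.
  have -> : 3 * E `^ s * (q%:R `^ (1 + eta) * q%:R `^ (- (e * s))) =
    3 * q%:R `^ (1 + eta) * c q by rewrite /c; ring.
  by rewrite ler_wpM2r//; lra.
by rewrite -mulr_sumr ler_wpM2l ?mulr_ge0 ?powR_ge0//; exact: psum_le.
Qed.

Lemma hausdorff_measure_phi0 : hausdorff_measure s (range (@phi R)) = 0%E.
Proof.
apply/eqP; rewrite eq_le; apply/andP; split; last first.
  have : (hausdorff_pre s 1 (range (@phi R)) <= hausdorff_measure s (range (@phi R)))%E.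
    by apply: ereal_sup_ubound; exists 1 => /=.
  apply: le_trans; apply: le_ereal_inf_tmp => _ [U _ <-].
  by apply: nneseries_ge0 => n _ _; exact: hterm_ge0.
apply: ge_ereal_sup => _ [delta /= d0 <-].
apply/lee_addgt0Pr => eps eps0; rewrite add0e.
have E1 : 0 < E + 1 by rewrite ltr_wpDl.
have [N1 h1] := powRN_small (lt_trans ltr01 e1) (divr_gt0 d0 E1).
pose C := 3 * E `^ s * a^-1 + 1.
have C0 : 0 < C.
  by rewrite ltr_wpDl// mulr_ge0 ?invr_ge0 ?(ltW a0)// mulr_ge0 ?powR_ge0.
have [N2 h2] := powRN_small a0 (divr_gt0 eps0 C0).
(* Beyond [N1] every piece has diameter at most [delta]; beyond [N2] the total cost is at most
   [eps]. The added 1 in [E + 1] and in [C] secures positive divisors. *)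
pose N := (N1 + N2).+1.
apply: (@le_trans _ _ (\sum_(0 <= n <oo) hterm s (pieces N.+1 n))%E).
  apply: ereal_inf_lbound; exists (pieces N.+1) => //; split; first exact: pieces_cover.
  move=> n; rewrite /pieces; case: (pickle_inv n) => [x|] /=; last first.
    by apply: diam_le => u v [].
  apply: diam_le => u v hu hv; apply: (le_trans (piece_dist_le hu hv)).
  case: ifPn => [/and3P[Nx _ _]|_]; last exact: ltW.
  have hx : x.2%:R `^ (- e) <= delta / (E + 1).
    by apply: h1; apply: leq_trans Nx; rewrite /N; lia.
  apply: (@le_trans _ _ ((E + 1) * (delta / (E + 1)))).
    by apply: ler_pM => //; rewrite ?powR_ge0// lerDl.
  by rewrite mulrC divfK// gt_eqF.
apply: (le_trans (@sum_hterm_pieces_le N isT)).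
rewrite lee_fin mulrA; apply: (@le_trans _ _ (C * (eps / C))); last first.
  by rewrite mulrC divfK// gt_eqF.
apply: ler_pM; rewrite ?powR_ge0 ?lerDl//.
- by rewrite mulr_ge0 ?invr_ge0 ?(ltW a0)// mulr_ge0 ?powR_ge0.
- by apply: h2; rewrite /N; lia.
Qed.

End Cover.

Lemma dim_phi_le43 : (hausdorff_dim (range (@phi R)) <= (4 / 3 : R)%:E)%E.
Proof.
apply/lee_addgt0Pr => eps eps0; apply: ereal_inf_lbound.
exists (4 / 3 + eps) => //; split; first by rewrite addr_ge0 ?(ltW eps0)// divr_ge0.
by apply: hausdorff_measure_phi0; rewrite ltrDl.
Qed.

End UpperBound.

Theorem theorem1p1 (R : realType) :
  (1%:E <= hausdorff_dim (range (@phi R)))%E /\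
  (hausdorff_dim (range (@phi R)) <= (4 / 3 : R)%:E)%E.
Proof. by split; [exact: dim_phi_ge1 | exact: dim_phi_le43]. Qed.
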